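(* Let $f:(0,\infty)\to(0,\infty)$ be a concave increasing function satisfying $\lim_{r\to\infty}f'(r)=1$. Then there exists an admissible sequence $(r_n)_{n\ge0}$ such that for both the synchronized rotations model and the independent rotations model, the associated random Cantor set $K$ satisfies $$\mathbb{E}\,\mathrm{Fav}(K(r))\approx f(r)\qquad\text{for all } r>0,$$ where the implied constants are absolute (in particular independent of $f$ and $r$).
   Context: Favard length: for $\theta\in[0,\pi]$ let $\mathrm{proj}_\theta(x)=x\cdot(\cos\theta,\sin\theta)$ for $x\in\mathbb{R}^2$; for a Borel set $E\subset\mathbb{R}^2$, $\mathrm{Fav}(E)=\int_0^\pi|\mathrm{proj}_\theta(E)|\,d\theta$, where $|\cdot|$ is one-dimensional Lebesgue measure. For a compact set $E$ and $r>0$, $E(r)=\{x:\mathrm{dist}(x,E)\le r\}$. Admissible sequence: a sequence $r_0\ge r_1\ge r_2\ge\cdots$ of nonnegative reals with $r_{n+1}\le \frac13 r_n$ for all $n\ge0$. The degenerate case in which $r_n=0$ for all $n$ from some index on (possibly from $n=0$) is allowed. Cantor set: let $[4]=\{0,1,2,3\}$, let $[4]^*$ be the set of finite words over $[4]$ (including the empty word $\varnothing$), and let $|\mathbf{i}|$ be the length of $\mathbf{i}$. Write $B(x,r)$ for the closed disc (a point if $r=0$) and $u(t)=(\cos t,\sin t)$. Given an admissible sequence $(r_n)$ and angles $(\omega_{\mathbf i})_{\mathbf i\in[4]^*}$ in $[0,2\pi]$, define $D_\varnothing=B(0,r_0)$, and if $|\mathbf i|=k$ and $D_{\mathbf i}=B(c_{\mathbf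 i},r_k)$, then for $j\in[4]$ put $D_{\mathbf i j}=B\big(c_{\mathbf i}+(r_k-r_{k+1})\,u(\omega_{\mathbf i}+\tfrac{2\pi j}{4}),\,r_{k+1}\big)$. Set $K_n=\bigcup_{|\mathbf i|=n}D_{\mathbf i}$ and $K=\bigcap_{n\ge0}K_n$. Random models (radii fixed, angles random). Synchronized rotations model: $\omega_0,\omega_1,\dots$ are i.i.d. uniform in $[0,2\pi]$ and $\omega_{\mathbf i}=\omega_{|\mathbf i|}$. Independent rotations model: all $\omega_{\mathbf i}$, $\mathbf i\in[4]^*$, are independent and uniform in $[0,2\pi]$. A concave function is differentiable outside a countable set; $\lim_{r\to\infty}f'(r)$ is understood along points of differentiability (equivalently, with one-sided derivatives). $X\approx Y$ means $cY\le X\le CY$ for constants $0<c\le C<\infty$. *)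

(* Defs.v *)
From HB Require Import structures.
From mathcomp Require Import all_boot all_order all_algebra.
From mathcomp Require Import all_classical all_reals all_analysis.

Set Implicit Arguments.
Unset Strict Implicit.
Unset Printing Implicit Defensive.

Import Order.TTheory GRing.Theory Num.Theory.
Import numFieldNormedType.Exports.

Local Open Scope classical_set_scope.
Local Open Scope ring_scope.

Section plane.
Context {R : realType}.

(* The library norm on R * R is the sup norm, so the Euclidean distance is
   defined by hand. *)
Definition euclid_dist (x y : R * R) : R :=
  Num.sqrt ((x.1 - y.1) ^+ 2 + (x.2 - y.2) ^+ 2).

Definition closed_disc (c : R * R) (r : R) : set (R * R) :=
  [set x | euclid_dist c x <= r].

(* The infimum is taken in \bar R, so that dist(x, set0) = +oo. *)
Definition dist_to_set (x : R * R) (E : set (R * R)) : \bar R :=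
  ereal_inf [set (euclid_dist x y)%:E | y in E].

Definition neighborhood (E : set (R * R)) (r : R) : set (R * R) :=
  [set x | (dist_to_set x E <= r%:E)%E].

Definition proj_dir (theta : R) (x : R * R) : R :=
  x.1 * cos theta + x.2 * sin theta.

Definition Fav (E : set (R * R)) : \bar R :=
  (\int[lebesgue_measure]_(theta in `[0%R, pi])
     lebesgue_measure (proj_dir theta @` E))%E.

Definition unit_vec (t : R) : R^o * R^o := (cos t, sin t).

End plane.

Section cantor_set.
Context {R : realType}.

Definition admissible (r : nat -> R) : Prop :=
  [/\ forall n, 0 <= r n,
      forall n, r n.+1 <= r n &
      forall n, r n.+1 <= 3^-1 * r n].

(* Words over {0,1,2,3} are stored with the last letter first: j :: i stands
   for the word i followed by the letter j. *)
Definition word := seq 'I_4.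

Fixpoint disc_center (r : nat -> R) (omega : word -> R) (i : word) : R * R :=
  if i is j :: i' then
    disc_center r omega i' + (r (size i') - r (size i').+1) *:
      unit_vec (omega i' + 2 * pi * j%:R / 4)
  else (0, 0).

Definition disc (r : nat -> R) (omega : word -> R) (i : word) : set (R * R) :=
  closed_disc (disc_center r omega i) (r (size i)).

Definition cantor_level (r : nat -> R) (omega : word -> R) (n : nat) :
    set (R * R) :=
  \bigcup_(i in [set i : word | size i = n]) disc r omega i.

Definition cantor (r : nat -> R) (omega : word -> R) : set (R * R) :=
  \bigcap_n cantor_level r omega n.

End cantor_set.

Section random_angles.
Context {R : realType} {d : measure_display} {T : measurableType d}
  (P : probability T R).

Definition mutually_independent (I : choiceType) (X : I -> {RV P >-> R}) :
    Prop :=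
  forall (J : seq I) (A : I -> set R), uniq J ->
    (forall i, i \in J -> measurable (A i)) ->
    P (\bigcap_(i in [set` J]) (X i @^-1` A i)) =
    (\prod_(i <- J) P (X i @^-1` A i))%E.

Lemma two_pi_gt0 : 0 < 2 * pi :> R.
Proof. by rewrite mulr_gt0 ?pi_gt0. Qed.

(* Both sides are total functions on sets, meaningful only on Borel sets. *)
Definition uniform_angle (X : {RV P >-> R}) : Prop :=
  forall A : set R, measurable A ->
    distribution P X A = uniform_prob two_pi_gt0 A.

Definition iid_uniform_angles (I : choiceType) (X : I -> {RV P >-> R}) :
    Prop :=
  mutually_independent X /\ forall i, uniform_angle (X i).

Definition synchronized_angles (X : nat -> {RV P >-> R}) (w : T) : word -> R :=
  fun i => X (size i) w.

Definition independent_angles (X : word -> {RV P >-> R}) (w : T) : word -> R :=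
  fun i => X i w.

Definition expected_Fav (r : nat -> R) (omega : T -> word -> R) (rho : R) :
    \bar R :=
  (\int[P]_w Fav (neighborhood (cantor r (omega w)) rho))%E.

End random_angles.

(* Main.v *)
Require Import Defs.
From HB Require Import structures.
From mathcomp Require Import all_boot all_order all_algebra.
From mathcomp Require Import all_classical all_reals all_analysis.
From mathcomp Require Import measurable_realfun.
From mathcomp Require Import ring lra.

Set Implicit Arguments.
Unset Strict Implicit.
Unset Printing Implicit Defensive.

Import Order.TTheory GRing.Theory Num.Theory.
Import numFieldNormedType.Exports.

Local Open Scope classical_set_scope.
Local Open Scope ring_scope.

(** Let [n] be the first level with [r n <= rho] and let the energy at scale
[rho] be the sum of the [4^-k / r k] over [k < n], plus [4^-n / rho]; this is
[energy r n rho]. For every admissible sequence the expected Favard length of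
the [rho]-neighbourhood is comparable to the inverse of the energy, and any
profile [f] as in the theorem is comparable to the inverse of the energy of a
suitable sequence. Three arguments carry this.

Lower bound, for every choice of the angles ([Fav_cantor_lower_bound]). Pick a
point of the Cantor set in each of the [4^n] discs of level [n]. In direction
[theta] the projected neighbourhood contains the union of the intervals of
radius [rho] around the projected points, and by the second moment method the
length of this union is at least the square of the total length divided by the
total overlap. Two points first separated below a disc of radius [r k] are at
distance at least [r k / 4], so their projections are within [2 rho] of each
other only for a set of directions of measure [O(rho / r k)]. Summing over
pairs, the overlap averaged over [theta] is the energy ([leaf_energy]).

Upper bound, in the mean, for a fixed direction ([mean_length_energy]). Let
[y v] be the expected length of the projection of what lies inside the disc
[v] of level [k]. Two opposite children of [v] move in opposite directions on
a circle as the angle at [v] turns, so their projections overlap, on average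
over that angle, in length at least a constant times [l0 * l2 / r k], where
[l0] and [l2] are the lengths of the two projections ([overlap_average]). The
angle at [v] is independent of the angles below it ([mean_overlap]), and the
mean of [l0 * l2] is at least the product of the means: with equality if the
children are independent, and because [l0 = l2] if they use the same angles.
If [Y] bounds the mean length of each child, inclusion-exclusion gives
[y <= 4 Y - c Y^2 / r k], whence [1 / y >= 1 / (4 Y) + c' / r k]
([overlap_gain]). Iterated over the levels, this recursion for [1 / y] adds up
the energy; Tonelli's theorem then integrates over [theta].

Choice of radii ([energy_profile]). The inverse of the energy can be any
concave profile with slope one at infinity. By concavity [1 / f] is, up to a
factor 5, the infimum of the functions [t |-> b k + 4^-k / t], where [b k] is
the least constant that makes such a function dominate [1 / f]
([line_le_profile]). The energy has the same shape, with the partial sums of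
[4^-k / r k] in place of [b n]; so [r k] is taken at the point where the
functions of index [k] and [k + 1] cross, unless this violates
[r (k + 1) <= r k / 3]. The slope condition enters through [t <= f t], which
makes [b 0 = 0], and through [f t < 4 * t] for some [t], which makes [b 1] positive. *)

(** * Concave profiles with slope one at infinity *)

Section concave.
Context {R : realType}.
Variable f : R -> R.
Hypothesis f_gt0 : forall x : R, 0 < x -> 0 < f x.
Hypothesis f_concave : convex_function (E := R^o) `]0, +oo[ (fun x : R => - f x).

Lemma concave_chord (x y z : R) : 0 < x -> x < y -> y < z ->
  f x * (z - y) + f z * (y - x) <= f y * (z - x).
Proof.
move=> x0 xy yz.
have zx : 0 < z - x by lra.
have t01 : 0 <= (z - y) / (z - x) <= 1.
  apply/andP; split; first by apply: divr_ge0; lra.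
  by rewrite ler_pdivrMr//; lra.
pose t : {i01 R} := Itv01 (andP t01).1 (andP t01).2.
have /= := f_concave t (x := x) (y := z).
rewrite !inE/= !in_itv/= !andbT => /(_ x0 (lt_trans x0 (lt_trans xy yz))).
rewrite convRE/= /unstable.onem.
have -> : conv t (x : convex_lmodType R^o) z = y.
  rewrite [LHS](_ : _ = (z - y) / (z - x) * x + (1 - (z - y) / (z - x)) * z) //.
  by field; lra.
move=> h; have := ler_wpM2r (ltW zx) h.
have -> : ((z - y) / (z - x) * - f x + (1 - (z - y) / (z - x)) * - f z) * (z - x)
  = - (f x * (z - y) + f z * (y - x)) by field; lra.
by rewrite mulNr lerN2.
Qed.

(** The quotient [f t / t] is non-increasing: apply concavity between a point
tending to [0], where [f] is positive, and [t]. *)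
Lemma concave_ratio (s t : R) : 0 < s -> s <= t -> s * f t <= t * f s.
Proof.
move=> s0; rewrite le_eqVlt => /predU1P[->//|st].
apply/ler_addgt0Pr => e e0.
have ft0 : 0 < f t by apply: f_gt0; lra.
pose d := Num.min (s / 2) (e / f t).
have d0 : 0 < d by rewrite lt_min !divr_gt0.
have ds : d < s by rewrite gt_min; apply/orP; left; lra.
have de : d * f t <= e by rewrite -ler_pdivlMr// ge_min lexx orbT.
have := concave_chord d0 ds st; have := f_gt0 d0; have := f_gt0 s0.
nra.
Qed.

(** If the two one-sided derivatives at [x] agree, then [f] is derivable there;
otherwise a rational lies strictly between them. *)
Lemma nonderivable_strict_tangent (x : R) : 0 < x -> ~ derivable (f : R^o -> R^o) x 1 ->
  exists m : rat, forall y, 0 < y -> y != x -> f y < f x + ratr m * (y - x).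
Proof.
move=> x0 ndf.
pose s y := (f y - f x) / (y - x).
have smono (y z : R) : 0 < y -> y < z -> y != x -> z != x -> s z <= s y.
  have sN w : s w = (f x - f w) / (x - w) by rewrite -mulrNN -invrN !opprB.
  move=> y0 yz /lt_total/orP[yx|xy] /lt_total/orP[zx|xz].
  - have := concave_chord y0 yz zx.
    by rewrite !sN ler_pdivrMr ?subr_gt0// mulrAC ler_pdivlMr ?subr_gt0//; lra.
  - have := concave_chord y0 yx xz.
    by rewrite (sN y) ler_pdivrMr ?subr_gt0// mulrAC ler_pdivlMr ?subr_gt0//; lra.
  - lra.
  - have := concave_chord x0 xy yz.
    by rewrite ler_pdivrMr ?subr_gt0// mulrAC ler_pdivlMr ?subr_gt0//; lra.
pose L := [set s y | y in `]0, x[].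
pose U := [set s y | y in `]x, +oo[].
have U0 : U !=set0 by exists (s (x + 1)), (x + 1) => //=; rewrite in_itv/=; lra.
have L0 : L !=set0 by exists (s (x / 2)), (x / 2) => //=; rewrite in_itv/=; lra.
have UL u l : U u -> L l -> u <= l.
  move=> [y] /=; rewrite in_itv/= andbT => xy <- [z] /=; rewrite in_itv/= => /andP[z0 zx] <-.
  by apply: smono => //; [exact: lt_trans zx xy|rewrite lt_eqF|rewrite gt_eqF].
have Ub : has_ubound U by have [l Ll] := L0; exists l => u Uu; exact: UL.
have Lb : has_lbound L by have [u Uu] := U0; exists u => l Ll; exact: UL.
have pq : sup U <= inf L.
  by apply: ge_sup => // u Uu; apply: lb_le_inf => // l Ll; exact: UL.
have [lpq|/(conj pq)/andP/le_anti epq] := ltP (sup U) (inf L).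
  have [m] := rat_in_itvoo lpq; rewrite in_itv/= => /andP[pm mq]; exists m => y y0.
  rewrite neq_lt => /orP[yx|xy].
  - have : ratr m < s y.
      by apply: lt_le_trans mq _; apply: ge_inf => //; exists y => //=; rewrite in_itv/= y0.
    rewrite /s -mulrNN -invrN !opprB ltr_pdivlMr; lra.
  - have : s y < ratr m.
      by apply: le_lt_trans pm; apply: ub_le_sup => //; exists y => //=; rewrite in_itv/= andbT.
    by rewrite /s ltr_pdivrMr; lra.
exfalso; apply: ndf; apply/cvg_ex; exists (sup U : R^o).
apply/cvgrPdist_lt => e e0.
have [_ [y1 /= + <-] hy1] := sup_adherent e0 (conj U0 Ub); rewrite in_itv/= andbT => xy1.
have [_ [y2 /= + <-] hy2] := inf_adherent e0 (conj L0 Lb); rewrite in_itv/= => /andP[y20 y2x].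
near=> h.
have h0 : h != 0 by near: h; exact: nbhs_dnbhs_neq.
have hh : `|h| < Num.min (y1 - x) (x - y2).
  near: h; apply: dnbhs0_lt. by rewrite lt_min; apply/andP; split; lra.
move: hh; rewrite lt_min => /andP[]; rewrite !ltr_norml => /andP[_ h2] /andP[h3 _].
rewrite /= [h%:A]mulr1.
rewrite [h^-1 *: _](_ : _ = s (h + x)); last by rewrite /s addrK mulrC.
have hx0 : 0 < h + x by move: (h3) (y20); clear; lra.
have := h0; rewrite neq_lt => /orP[hn|hp].
- have hx : h + x < x by rewrite gtrDr.
  have h1x : s (h + x) <= s y2.
    by apply: smono; rewrite ?lt_eqF//; move: (h3); clear; lra.
  have h2x : inf L <= s (h + x).
    by apply: ge_inf => //; exists (h + x) => //=; rewrite in_itv/= hx0.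
  by move: (hy2) (h1x) (h2x) (e0); rewrite epq; clear=> ? ? ? ?; apply/andP; split; lra.
- have hx : x < h + x by rewrite ltrDr.
  have h1x : s y1 <= s (h + x).
    by apply: smono; rewrite ?gt_eqF//; move: (h2); clear; lra.
  have h2x : s (h + x) <= sup U.
    by apply: ub_le_sup => //; exists (h + x) => //=; rewrite in_itv/= andbT.
  by move: (hy1) (h1x) (h2x) (e0); clear=> ? ? ? ?; apply/andP; split; lra.
Unshelve. all: by end_near. Qed.

(** A slope that is strictly tangent at one point is not tangent at any other,
so the rational slopes of the preceding lemma are pairwise distinct. *)
Lemma countable_nonderivable : countable [set x : R | 0 < x /\ ~ derivable (f : R^o -> R^o) x 1].
Proof.
pose m (x : R) := if pselect (exists m : rat, forall y, 0 < y -> y != x -> f y < f x + ratr m * (y - x)) is left h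
  then projT1 (cid h) else 0.
set A := [set x | _].
have mP (x : R) : A x -> forall y, 0 < y -> y != x -> f y < f x + ratr (m x) * (y - x).
  move=> [x0 /(nonderivable_strict_tangent x0) h]; rewrite /m; case: pselect => // h'.
  by case: cid.
have mi : {in A &, injective m}.
  move=> x y /set_mem Ax /set_mem Ay mxy; apply/eqP; apply: contrapT => /negP xy.
  have := mP _ Ax _ Ay.1; rewrite eq_sym xy => /(_ isT).
  have := mP _ Ay _ Ax.1; rewrite xy => /(_ isT).
  by rewrite mxy; lra.
apply/countable_injP; exists (pickle \o m) => x y Ax Ay /= /(pcan_inj pickleK).
exact: mi.
Qed.

(** The limit of the derivative is taken along the points of derivability; this
lemma shows that the filter is proper, so that the limit carries information. *)
Lemma exists_derivable (M : R) : exists x, [/\ M < x, 0 < x & derivable (f : R^o -> R^o) x 1].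
Proof.
pose M' := Num.max M 0.
have [|] := pselect (exists x, M' < x /\ derivable (f : R^o -> R^o) x 1).
  by move=> [x [+ dx]]; rewrite gt_max => /andP[]; exists x.
move=> /forallNP h; exfalso.
have sub : `]M', (M' + 1)] `<=` [set x : R | 0 < x /\ ~ derivable (f : R^o -> R^o) x 1].
  move=> x /=; rewrite in_itv/= => /andP[Mx _]; split.
    by apply: le_lt_trans Mx; rewrite le_max lexx orbT.
  by move=> dx; apply: (h x).
have := countable_lebesgue_measure0 (sub_countable (subset_card_le sub) countable_nonderivable).
by rewrite lebesgue_measure_itv/= lte_fin ltrDl ltr01 -EFinB addrAC subrr add0r => /eqP; rewrite eqe oner_eq0.
Qed.

Lemma concave_tangent (x y : R) : 0 < x -> 0 < y -> derivable (f : R^o -> R^o) x 1 ->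
  f y <= f x + derive1 f x * (y - x).
Proof.
move=> x0 y0 dx.
have [->|] := eqVneq y x; first by rewrite subrr mulr0 addr0.
rewrite derive1E.
have cv : h^-1 *: (f (h + x) - f x) @[h --> 0^'] --> 'D_1 (f : R^o -> R^o) x.
  have := dx; rewrite /derivable/= /derive.
  by under eq_fun do rewrite [_%:A]mulr1.
rewrite neq_lt => /orP[yx|xy].
- suff : 'D_1 (f : R^o -> R^o) x <= (f x - f y) / (x - y).
    by rewrite ler_pdivlMr ?subr_gt0//; lra.
  apply: (cvgr_to_le (cvg_dnbhs_at_left cv)).
  near=> h.
  have h0 : h < 0 by near: h; exact: nbhs_left_lt.
  have hy : y < h + x by rewrite -ltrBlDr; near: h; apply: nbhs_left_gt; rewrite subr_lt0.
  have hx : h + x < x by rewrite gtrDr.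
  rewrite [_ *: _](_ : _ = (f x - f (h + x)) / - h); last first.
    by rewrite invrN mulrN -mulNr opprB mulrC.
  have := concave_chord y0 hy hx.
  rewrite ler_pdivlMr ?subr_gt0// mulrAC ler_pdivrMr ?oppr_gt0//.
  by clear; lra.
- suff : (f y - f x) / (y - x) <= 'D_1 (f : R^o -> R^o) x.
    by rewrite ler_pdivrMr ?subr_gt0//; lra.
  apply: (cvgr_to_ge (cvg_dnbhs_at_right cv)).
  near=> h.
  have h0 : 0 < h by near: h; exact: nbhs_right_gt.
  have hy : h + x < y by rewrite -ltrBrDr; near: h; apply: nbhs_right_lt; rewrite subr_gt0.
  have hx : x < h + x by rewrite ltrDr.
  rewrite [_ *: _](_ : _ = (f (h + x) - f x) / h); last by rewrite mulrC.
  have := concave_chord x0 hx hy.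
  rewrite ler_pdivlMr// mulrAC ler_pdivrMr ?subr_gt0//.
  by clear; lra.
Unshelve. all: by end_near. Qed.

Hypothesis f_lim : derive1 f x @[x --> within [set x | derivable f x 1] +oo] --> (1 : R).

Lemma exists_slope_near1 (e M : R) : 0 < e ->
  exists x, [/\ M < x, 0 < x, derivable (f : R^o -> R^o) x 1 & `|derive1 f x - 1| < e].
Proof.
move=> e0.
have := f_lim; move/cvgrPdist_lt => /(_ e e0).
rewrite near_withinE => -[N [Nr HN]].
have [x [xM x0 dx]] := exists_derivable (Num.max M N).
move: xM; rewrite gt_max => /andP[xM xN].
by exists x; split => //; rewrite distrC; apply: HN.
Qed.

(** At points [x] far away the derivative is close to [1], and [f x] is at least
[x] times the derivative since the tangent at [x] is non-negative at [0];
the monotonicity of [f t / t] carries the inequality back to [t]. *)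
Lemma profile_ge_id (t : R) : 0 < t -> t <= f t.
Proof.
move=> t0.
suff h e : 0 < e -> (1 - e) * t <= f t.
  apply/ler_addgt0Pr => e e0; have := h (e / t) (divr_gt0 e0 t0).
  by rewrite mulrBl divfK ?gt_eqF// mul1r; lra.
move=> e0; have [x [tx x0 dx]] := exists_slope_near1 t e0.
rewrite ltr_norml => /andP[he _].
have dpos : derive1 f x * x <= f x.
  apply/ler_addgt0Pr => e1 e10.
  pose y := e1 / (`|derive1 f x| + 1).
  have y0 : 0 < y by rewrite divr_gt0// ltr_wpDl.
  have := concave_tangent x0 y0 dx; have := f_gt0 y0.
  have : derive1 f x * y <= e1.
    apply: le_trans (ler_wpM2r (ltW y0) (ler_norm _)) _.
    by rewrite mulrA ler_pdivrMr ?ltr_wpDl// mulrC; nra.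
  lra.
have := concave_ratio t0 (ltW tx).
have : (1 - e) * x <= f x by apply: le_trans dpos; rewrite ler_pM2r//; lra.
move=> h1 h2; rewrite -(ler_pM2r x0) (mulrC (f t)).
by apply: le_trans h2; rewrite mulrAC mulrC ler_pM2l.
Qed.

(** Beyond a point [x] where the derivative is below [2] the tangent grows more
slowly than [4 * t]; at [t = x + f x] its value is less than [3 * f x]. *)
Lemma profile_lt_linear : exists2 t, 0 < t & f t < 4 * t.
Proof.
have [x [_ x0 dx]] := exists_slope_near1 0 ltr01.
rewrite ltr_norml => /andP[_ he].
exists (x + f x); first by have := f_gt0 x0; lra.
have := f_gt0 x0 => fx0.
have xf : 0 < x + f x by lra.
have := concave_tangent x0 xf dx.
rewrite addrAC subrr add0r; nra.
Qed.
End concave.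

Lemma exists_pow_lt {R : archiRealFieldType} (q c e : R) : 0 <= q -> q < 1 -> 0 < e ->
  exists n, c * q ^+ n < e.
Proof.
move=> q0 q1 e0.
have q1' : `|q| < 1 by rewrite ger0_norm.
have := cvg_geometric c q1'; move/cvgrPdist_lt => /(_ e e0)[N _ HN].
exists N; have := HN N (leqnn N); rewrite /= sub0r normrN.
exact/le_lt_trans/ler_norm.
Qed.

(** The energy of the natural measure on the Cantor set at scale [rho], when [n] is
the level whose discs have radius about [rho]: the mean of the inverse distance
between two random points, truncated at [rho], up to constants. *)
Definition energy {R : realType} (r : nat -> R) (n : nat) (rho : R) : R :=
  \sum_(k < n) 4^-1 ^+ k / r k + 4^-1 ^+ n / rho.

(** * Radii whose energy follows a prescribed profile *)

Section radii.
Context {R : realType}.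
Variable f : R -> R.
Hypothesis f_gt0 : forall x : R, 0 < x -> 0 < f x.
Hypothesis f_mono : forall x y : R, 0 < x -> x <= y -> f x <= f y.
Hypothesis f_ratio : forall s t : R, 0 < s -> s <= t -> s * f t <= t * f s.
Hypothesis f_ge : forall t : R, 0 < t -> t <= f t.
Hypothesis f_lin : exists2 t : R, 0 < t & f t < 4 * t.

(** [intercept k] is the least [b] such that [b + 4^-k / t] dominates [1 / f t] for
all [t]. It exists when [excess k] is bounded above, which fails exactly when [f t] is
too small near [0] compared with [4^k * t]; then [sup] has a junk value. *)
Definition excess (k : nat) : set R :=
  [set (f t)^-1 - 4^-1 ^+ k / t | t in `]0, +oo[].
Definition intercept (k : nat) : R := sup (excess k).

Lemma quarter_pow_gt0 (k : nat) : 0 < 4^-1 ^+ k :> R.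
Proof. by rewrite exprn_gt0// invr_gt0. Qed.
Local Hint Resolve quarter_pow_gt0 : core.

Lemma excess_neq0 k : excess k !=set0.
Proof. by exists ((f 1)^-1 - 4^-1 ^+ k / 1); exists 1 => //=; rewrite in_itv/= ltr01. Qed.

Lemma le_intercept_line k (t : R) : has_ubound (excess k) -> 0 < t ->
  (f t)^-1 <= intercept k + 4^-1 ^+ k / t.
Proof.
move=> ub t0; rewrite -lerBlDr; apply: ub_le_sup => //.
by exists t => //=; rewrite in_itv/= t0.
Qed.

Lemma intercept_le k (x : R) :
  (forall t : R, 0 < t -> (f t)^-1 <= x + 4^-1 ^+ k / t) ->
  has_ubound (excess k) /\ intercept k <= x.
Proof.
move=> h; have ubx : ubound (excess k) x.
  by move=> _ [t /= + <-]; rewrite in_itv/= andbT lerBlDr; exact: h.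
by split; [exists x|apply: ge_sup => //; exact: excess_neq0].
Qed.

(** As [t] grows, [4^-k / t] tends to [0] while [1 / f t] stays positive. *)
Lemma intercept_ge0 k : has_ubound (excess k) -> 0 <= intercept k.
Proof.
move=> ub; apply/ler_addgt0Pr => e e0.
have t0 : 0 < 4^-1 ^+ k / e by rewrite divr_gt0.
have := le_intercept_line ub t0.
rewrite [_ / (_ / _)](_ : _ = e); last by field; rewrite !gt_eqF.
have : 0 < (f (4^-1 ^+ k / e))^-1 by rewrite invr_gt0 f_gt0.
lra.
Qed.

Lemma intercept0 : has_ubound (excess 0) /\ intercept 0 = 0.
Proof.
have [ub b0] : has_ubound (excess 0) /\ intercept 0 <= 0.
  apply: intercept_le => t t0; rewrite add0r expr0 div1r lef_pV2 ?posrE ?f_gt0//.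
  exact: f_ge.
by split => //; apply/eqP; rewrite eq_le b0 intercept_ge0.
Qed.

Lemma intercept_mono k l : (k <= l)%N -> has_ubound (excess l) ->
  has_ubound (excess k) /\ intercept k <= intercept l.
Proof.
move=> kl ub; apply: intercept_le => t t0.
apply: le_trans (le_intercept_line ub t0) _.
rewrite lerD2l ler_pM2r ?invr_gt0// ler_wiXn2l//; lra.
Qed.

Lemma intercept1_gt0 : has_ubound (excess 1) -> 0 < intercept 1.
Proof.
move=> ub; have [t t0 ft] := f_lin.
have := le_intercept_line ub t0; rewrite -lerBlDr; apply: lt_le_trans.
by rewrite subr_gt0 expr1 -invfM ltf_pV2 ?posrE ?f_gt0// mulr_gt0.
Qed.

Lemma quarter_pow_sandwich (x : R) : 0 < x -> x <= 1 ->
  exists k, x <= 4^-1 ^+ k /\ 4^-1 ^+ k <= 4 * x.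
Proof.
move=> x0 x1.
have [] : exists n, 4^-1 ^+ n < x.
  have q0 : (0 : R) <= 4^-1 by rewrite invr_ge0.
  have q1 : (4^-1 : R) < 1 by rewrite invf_lt1// ltr1n.
  by have [N] := exists_pow_lt 1 q0 q1 x0; rewrite mul1r; exists N.
move=> N HN; have ex : exists n, 4^-1 ^+ n < x by exists N.
case: (ex_minnP ex) => -[|k] kx kmin; first by move: kx; rewrite expr0; lra.
exists k; split; first by rewrite leNgt; apply/negP => /kmin; rewrite ltnn.
by move: kx; rewrite exprS; lra.
Qed.

(** Choose [k] with [4^-k] between [t / f t] and [4 t / f t]. The function
[1 / f t + 4^-k / s] of [s] dominates [1 / f s], by monotonicity of [f] for
[s >= t] and by monotonicity of [f s / s] for [s <= t]; its value at [t] is at most [5 / f t]. *)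
Lemma line_le_profile (t : R) : 0 < t ->
  exists k, has_ubound (excess k) /\ intercept k + 4^-1 ^+ k / t <= 5 / f t.
Proof.
move=> t0; have ft0 := f_gt0 t0.
have x0 : 0 < t / f t by rewrite divr_gt0.
have x1 : t / f t <= 1 by rewrite ler_pdivrMr// mul1r f_ge.
have [k [k1 k2]] := quarter_pow_sandwich x0 x1.
have [ub bk] : has_ubound (excess k) /\ intercept k <= (f t)^-1.
  apply: intercept_le => s s0.
  have [st|/ltW ts] := leP t s.
    apply: ler_wpDr; first by rewrite divr_ge0// ltW.
    by rewrite lef_pV2 ?posrE ?f_gt0//; exact: f_mono.
  apply: ler_wpDl; first by rewrite invr_ge0 ltW.
  have : (f s)^-1 <= t / f t / s.
    rewrite ler_pdivlMr// mulrC ler_pdivrMr ?f_gt0// mulrAC ler_pdivlMr//.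
    exact: f_ratio.
  by move/le_trans; apply; rewrite ler_pM2r ?invr_gt0.
exists k; split => //.
have : 4^-1 ^+ k / t <= 4 / f t.
  by rewrite ler_pdivrMr// mulrAC -mulrA.
move: bk; rewrite (_ : 5 / f t = 4 / f t + (f t)^-1); last by field; rewrite gt_eqF.
by move=> ? ?; rewrite addrC lerD.
Qed.

(** The functions of index [n] and [n + 1] cross at the [t] with
[t * (b (n + 1) - b n) = 3 / 4 * 4^-n]; the radius is this [t], or a third of the
previous radius if that is smaller. If [b (n + 1)] is infinite then the
function of index [n] is the last one, and the radii vanish from index [n] on:
the discs shrink to points. *)
Fixpoint radius (n : nat) : R :=
  if `[< has_ubound (excess n.+1) >] then
    let step := intercept n.+1 - intercept n in
    if n is m.+1 then
      if radius m / 3 * step <= 3 / 4 * 4^-1 ^+ n then radius m / 3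
      else 3 / 4 * 4^-1 ^+ n / step
    else 3 / 4 / step
  else 0.

Lemma radius_ge0 n : 0 <= radius n.
Proof.
elim: n => [|n IH] /=; case: asboolP => // ub.
  by rewrite divr_ge0// subr_ge0 intercept0.2 intercept_ge0.
case: ifPn => _; first by rewrite divr_ge0.
rewrite divr_ge0 ?mulr_ge0 ?(ltW (quarter_pow_gt0 _))// subr_ge0.
by have [] := intercept_mono (leqnSn n.+1) ub.
Qed.

Lemma radius_third n : radius n.+1 <= radius n / 3.
Proof.
rewrite [leLHS]/=; case: asboolP => [ub|_]; last by rewrite divr_ge0// radius_ge0.
case: ifPn => [//|]; rewrite -ltNge => h.
have step0 : 0 < intercept n.+2 - intercept n.+1.
  rewrite ltNge; apply/negP => s0; have := quarter_pow_gt0 n.+1 => q0.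
  have : radius n / 3 * (intercept n.+2 - intercept n.+1) <= 0.
    by rewrite mulr_ge0_le0// divr_ge0// radius_ge0.
  lra.
by rewrite ler_pdivrMr// ltW.
Qed.

Lemma radius_admissible : admissible radius.
Proof.
split=> n; first exact: radius_ge0.
  by apply: le_trans (radius_third n) _; have := radius_ge0 n; lra.
by rewrite mulrC; exact: radius_third.
Qed.

Lemma radius_gt0_bounded n : 0 < radius n -> has_ubound (excess n.+1).
Proof. by case: n => [|n] /=; case: asboolP => //; rewrite ltxx. Qed.

Lemma radius_step_le n : has_ubound (excess n.+1) ->
  radius n * (intercept n.+1 - intercept n) <= 3 / 4 * 4^-1 ^+ n.
Proof.
move=> ub; case: n ub => [|n] ub; rewrite [radius _]/=; case: asboolP => // _.
  rewrite intercept0.2 subr0 divfK ?expr0 ?mulr1// gt_eqF//.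
  exact: intercept1_gt0.
case: ifPn => // h.
have [->|s0] := eqVneq (intercept n.+2 - intercept n.+1) 0; last by rewrite divfK.
by rewrite mulr0 mulr_ge0// ltW.
Qed.

Lemma radius_step_eq n : has_ubound (excess n.+1) ->
  (0 < n)%N /\ radius n = radius n.-1 / 3 \/
  radius n * (intercept n.+1 - intercept n) = 3 / 4 * 4^-1 ^+ n.
Proof.
move=> ub; case: n ub => [|n] ub; rewrite [radius _]/=; case: asboolP => // _.
  right; rewrite intercept0.2 subr0 divfK ?expr0 ?mulr1// gt_eqF//.
  exact: intercept1_gt0.
case: ifPn => // [|h]; first by left.
right; rewrite divfK//; apply/negP => /eqP s0; move: h.
by rewrite s0 mulr0 mulr_ge0// ltW.
Qed.

(** A radius equal to a third of the previous one multiplies the term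
[4^-k / r k] by [3 / 4], so such terms are dominated by a geometric series
starting at the last crossing point, where the term is exactly [4 / 3] times an
increment of the intercept. The proof adds three times the last term to the
sum to turn this into an induction. *)
Lemma partial_sum_le_intercept n : (forall k : nat, (k < n)%N -> 0 < radius k) ->
  \sum_(k < n) 4^-1 ^+ k / radius k <= 16 / 3 * intercept n.
Proof.
case: n => [|n]; first by rewrite big_ord0 intercept0.2 mulr0.
move=> rpos.
suff h : \sum_(k < n.+1) 4^-1 ^+ k / radius k + 3 * (4^-1 ^+ n / radius n) <=
    16 / 3 * intercept n.+1.
  apply: le_trans h; rewrite lerDl mulr_ge0// divr_ge0 ?radius_ge0//.
elim: n rpos => [|n IH] rpos.
  have r0 := rpos 0%N (ltnSn 0); have ub := radius_gt0_bounded r0.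
  have [[]//|] := radius_step_eq ub.
  rewrite intercept0.2 subr0 big_ord1 expr0 mulr1 => e.
  have -> : 1 / radius 0 = 4 / 3 * intercept 1.
    by apply: (mulfI (lt0r_neq0 r0)); rewrite [RHS]mulrCA e; field; rewrite gt_eqF.
  lra.
have {}IH := IH (fun k kn => rpos k (leqW kn)).
have rn0 := rpos n.+1 (ltnSn _); have ub := radius_gt0_bounded rn0.
have rn'0 := rpos n (leqnSn _).
have [_ bn] := intercept_mono (leqnSn n.+1) ub.
rewrite big_ord_recr/=.
suff : 4^-1 ^+ n.+1 / radius n.+1 <= 3 / 4 * (4^-1 ^+ n / radius n)
    + 4 / 3 * (intercept n.+2 - intercept n.+1) by lra.
have e0 : 0 <= 4^-1 ^+ n / radius n by rewrite divr_ge0 ?ltW// quarter_pow_gt0.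
have [[_ rn]|e] := radius_step_eq ub.
- have -> : 4^-1 ^+ n.+1 / radius n.+1 = 3 / 4 * (4^-1 ^+ n / radius n).
    by rewrite [radius n.+1]rn/= exprS; field; rewrite gt_eqF.
  lra.
- have -> : 4^-1 ^+ n.+1 / radius n.+1 = 4 / 3 * (intercept n.+2 - intercept n.+1).
    by apply: (mulfI (lt0r_neq0 rn0)); rewrite [RHS]mulrCA e; field; rewrite gt_eqF.
  lra.
Qed.

(** A radius never exceeds the crossing point, so each term [4^-k / r k] is at
least [4 / 3] times an increment of the intercept. *)
Lemma intercept_le_partial_sum n : (forall k : nat, (k < n)%N -> 0 < radius k) ->
  intercept n <= 3 / 4 * \sum_(k < n) 4^-1 ^+ k / radius k.
Proof.
elim: n => [|n IH] rpos; first by rewrite big_ord0 intercept0.2 mulr0.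
have {}IH := IH (fun k kn => rpos k (ltnW kn)).
have rn0 := rpos n (ltnSn n).
have := radius_step_le (radius_gt0_bounded rn0).
rewrite mulrC -ler_pdivlMr// big_ord_recr/= -mulrA; lra.
Qed.

(** As long as the radii are at least [rho], the crossing points are to the right of
[rho], so at [rho] the functions decrease in the index. *)
Lemma intercept_gap n rho k : 0 < rho -> (forall k : nat, (k < n)%N -> rho <= radius k) ->
  (k <= n)%N -> intercept n <= intercept k + 4^-1 ^+ k / rho.
Proof.
move=> rho0 hr kn.
have q0 := quarter_pow_gt0.
suff h m : (k + m <= n)%N -> intercept (k + m) + 4^-1 ^+ (k + m) / rho <= intercept k + 4^-1 ^+ k / rho.
  have := h (n - k)%N; rewrite subnKC// => /(_ (leqnn _)).
  have : 0 < 4^-1 ^+ n / rho by rewrite divr_gt0.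
  lra.
elim: m => [|m IH]; first by rewrite addn0.
rewrite addnS => kmn; have {}IH := IH (ltnW kmn).
have rr := hr _ kmn; have r0 := lt_le_trans rho0 rr.
have := radius_step_le (radius_gt0_bounded r0).
rewrite mulrC -ler_pdivlMr// exprS.
have : 4^-1 ^+ (k + m) / radius (k + m) <= 4^-1 ^+ (k + m) / rho.
  by rewrite ler_pM2l// lef_pV2 ?posrE.
move: IH; set u := 4^-1 ^+ _; rewrite -!mulrA; lra.
Qed.

(** By the two comparisons of the partial sums with the intercepts, the energy at
scale [rho] is comparable to the function of index [n] at [rho]. Such a function
dominates [1 / f rho], and by [line_le_profile] some function, of index [k] say,
is at most [5 / f rho]. The functions cross to the right of [rho] for
indices below [n] and (up to the correction by thirds) to the left of [rho] at
index [n], so [n] does nearly as well as [k]. *)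
Lemma energy_profile n (rho : R) : 0 < rho -> radius n <= rho ->
  (forall k : nat, (k < n)%N -> rho <= radius k) ->
  (f rho)^-1 <= energy radius n rho /\ energy radius n rho <= 55 / f rho.
Proof.
move=> rho0 rn hr.
have rpos (k : nat) : (k < n)%N -> 0 < radius k by move/hr; exact: lt_le_trans.
have S0 : 0 <= \sum_(k < n) 4^-1 ^+ k / radius k.
  by apply: sumr_ge0 => k _; rewrite divr_ge0 ?radius_ge0// ltW ?quarter_pow_gt0.
have sum_le := partial_sum_le_intercept rpos.
have le_sum := intercept_le_partial_sum rpos.
have ub : has_ubound (excess n).
  by case: n {rn hr S0 sum_le le_sum} rpos => [|n] rpos; [exact: intercept0.1|exact/radius_gt0_bounded/rpos].
have qn0 : 0 < 4^-1 ^+ n / rho by rewrite divr_gt0 ?quarter_pow_gt0.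
rewrite /energy; split; first by have := le_intercept_line ub rho0; lra.
have [k [ubk hk]] := line_le_profile rho0.
have qk0 : 0 < 4^-1 ^+ k / rho by rewrite divr_gt0 ?quarter_pow_gt0.
have bk0 := intercept_ge0 ubk.
have -> : 55 / f rho = 11 * (5 / f rho) by field; rewrite gt_eqF// f_gt0.
have [kn|nk] := leqP k n.
  have gap := intercept_gap rho0 hr kn.
  have : 4^-1 ^+ n / rho <= 4^-1 ^+ k / rho.
    by rewrite ler_pM2r ?invr_gt0// ler_wiXn2l//; lra.
  lra.
have [ubn1 bn1] := intercept_mono nk ubk.
have [_ bnn1] := intercept_mono (leqnSn n) ubn1.
suff : 4^-1 ^+ n / rho <= 3 / 4 * \sum_(k < n) 4^-1 ^+ k / radius k + 4 / 3 * intercept n.+1.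
  by have := intercept_ge0 ub; lra.
have [[n0 rn3]|e] := radius_step_eq ubn1.
- case: n {ub nk ubn1 bn1 bnn1 sum_le le_sum} n0 rn3 hr qn0 rn rpos S0 => // n _ rn3 hr _ rn rpos _.
  have r0 := rpos n (ltnSn n).
  have rn10 : 0 < radius n.+1 by rewrite rn3 divr_gt0.
  have e1 : 4^-1 ^+ n.+1 / rho <= 3 / 4 * (4^-1 ^+ n / radius n).
    have -> : 3 / 4 * (4^-1 ^+ n / radius n) = 4^-1 ^+ n.+1 / radius n.+1.
      by rewrite [radius n.+1]rn3/= exprS; field; rewrite gt_eqF.
    by rewrite ler_pM2l ?quarter_pow_gt0// lef_pV2 ?posrE.
  have : 0 <= \sum_(i < n) 4^-1 ^+ i / radius i.
    by apply: sumr_ge0 => i _; rewrite divr_ge0 ?radius_ge0// ltW ?quarter_pow_gt0.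
  rewrite big_ord_recr/=; have := intercept_ge0 (radius_gt0_bounded rn10).
  lra.
- have := intercept_ge0 ub.
  suff : 4^-1 ^+ n / rho <= 4 / 3 * (intercept n.+1 - intercept n) by lra.
  rewrite ler_pdivrMr//.
  have : radius n * (intercept n.+1 - intercept n) <= rho * (intercept n.+1 - intercept n).
    by rewrite ler_wpM2r// subr_ge0.
  rewrite e; lra.
Qed.
End radii.

(** * Outer measure and integration without measurability *)

(** The projections of a neighbourhood of the Cantor set, and the Favard length as a
function of the angles, are only bounded from above and below, so monotonicity
for arbitrary sets and functions avoids any discussion of their measurability. *)

Section lebesgue_outer.
Context {R : realType}.
Implicit Types A B : set R.

Lemma lebesgue_measure_mono A B : A `<=` B ->
  (lebesgue_measure A <= lebesgue_measure B)%E.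
Proof.
rewrite /lebesgue_measure /lebesgue_stieltjes_measure /measure_extension => AB.
by apply: le_mu_ext; exact: AB.
Qed.

Lemma lebesgue_measureU2 A B :
  (lebesgue_measure (A `|` B) <= lebesgue_measure A + lebesgue_measure B)%E.
Proof.
rewrite /lebesgue_measure /lebesgue_stieltjes_measure /measure_extension.
exact: (outer_measureU2 (mu_ext (wlength idfun))).
Qed.

Lemma lebesgue_measure_cball (c e : R) : 0 <= e ->
  lebesgue_measure `[c - e, c + e]%classic = (2 * e)%:E.
Proof.
move=> e0; rewrite lebesgue_measure_itv/= lte_fin.
by case: ifPn => [_|]; [rewrite -EFinD; congr EFin; ring|move=> h; congr EFin; lra].
Qed.

Lemma lebesgue_measureUI (A B : set R) : measurable A -> measurable B ->
  (lebesgue_measure (A `|` B) + lebesgue_measure (A `&` B) =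
   lebesgue_measure A + lebesgue_measure B)%E.
Proof.
move=> mA mB.
have -> : A `|` B = A `|` (B `\` A) by rewrite setDE setUIr setUCr setIT.
rewrite measureU//; last 2 first.
- exact: measurableD.
- by rewrite setDE setIC -setIA setICl setI0.
rewrite -addeA; congr (_ + _)%E; rewrite setIC.
by apply: esym; exact: measureDI.
Qed.

End lebesgue_outer.

Section integral_mono.
Context d (T : measurableType d) {R : realType} (mu : {measure set T -> \bar R}).
Local Open Scope ereal_scope.

(** The integral of a non-negative function is a supremum over the simple
functions below it, hence monotone even on non-measurable functions. *)
Lemma ge0_le_integral_nomeas (D : set T) (f g : T -> \bar R) :
  (forall x, D x -> 0 <= f x) -> (forall x, D x -> f x <= g x) ->
  \int[mu]_(x in D) f x <= \int[mu]_(x in D) g x.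
Proof.
move=> f0 fg; have g0 x : D x -> 0 <= g x by move=> Dx; exact: le_trans (f0 x Dx) (fg x Dx).
rewrite !ge0_integralE//; apply: ereal_sup_le => _ [h /= hf <-].
exists h => // x; apply: le_trans (hf x) _.
by rewrite /patch; case: ifPn => // /set_mem; exact: fg.
Qed.
End integral_mono.

(** * A second moment bound for a union of intervals *)

Section near_set.
Context {R : realType}.
Implicit Types (rho lam : R) (cs : seq R).

Definition near_set rho cs : set R := [set t | has (fun c => `|t - c| <= rho) cs].

Lemma measurable_near_set d (U : measurableType d) rho (cs : seq (U -> R)) :
  (forall c, List.In c cs -> measurable_fun setT c) ->
  measurable [set ut : U * R | near_set rho [seq c ut.1 | c <- cs] ut.2].
Proof.
elim: cs => [|c cs IH] mcs.
  rewrite [X in measurable X](_ : _ = set0); first exact: measurable0.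
  by apply/seteqP; split.
rewrite [X in measurable X](_ : _ =
   ((fun ut : U * R => `|ut.2 - c ut.1|) @^-1` `]-oo, rho]) `|`
   [set ut : U * R | near_set rho [seq c ut.1 | c <- cs] ut.2]).
  apply: measurableU; last by apply: IH => c' ?; apply: mcs; right.
  rewrite -[X in measurable X]setTI.
  have mc : measurable_fun setT c by apply: mcs; left.
  have : measurable_fun setT (fun ut : U * R => `|ut.2 - c ut.1|).
    apply: measurableT_comp => //; apply: measurable_funB; first exact: measurable_snd.
    by apply: measurableT_comp => //; exact: measurable_fst.
  by apply => //; exact: measurable_itv.
apply/seteqP; split => -[u t]; rewrite /near_set/= in_itv/=.
  by move/orP.
by move=> /orP.
Qed.

(** Let [Z] count the intervals that contain a point. On the union
[2 * lam * Z <= 1 + (lam * Z) ^ 2], elsewhere [Z = 0]; integrate this. Optimizing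
[lam] would give the Cauchy-Schwarz bound; keeping it free makes both sides
additive, so that the inequality can be integrated over directions first. *)
Lemma near_set_energy rho lam cs : 0 <= rho -> 0 <= lam ->
  ((2 * lam * (2 * rho) * (size cs)%:R)%R%:E <=
   lebesgue_measure (near_set rho cs) +
   (lam ^+ 2 * (2 * rho) * \sum_(c <- cs) \sum_(c' <- cs) (`|c - c'| <= 2 * rho)%R%:R)%R%:E)%E.
Proof.
move=> rho0 lam0.
pose I c : set R := `[c - rho, c + rho]%classic.
have IE c t : I c t = (`|t - c| <= rho) :> Prop.
  by rewrite /I/= in_itv/= ler_distl.
pose Z t : R := \sum_(c <- cs) \1_(I c) t.
pose U := near_set rho cs.
have mI c : measurable (I c) by exact: measurable_itv.
have mU : measurable U.
  rewrite (_ : U = \big[setU/set0]_(c <- cs) I c); first exact: bigsetU_measurable.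
  rewrite /U; elim: (cs) => [|c l IH]; first by rewrite big_nil; apply/seteqP; split.
  rewrite big_cons -IH; apply/seteqP; split => t; rewrite /near_set/=.
    by move=> /orP[h|h]; [left; rewrite IE|right].
  by move=> [|h]; [rewrite IE => ->|rewrite h orbT].
have ptw t : 2 * lam * Z t <= \1_U t + lam ^+ 2 * (Z t ^+ 2).
  rewrite indicE; have [Ut|nUt] := boolP (t \in U).
    by have := sqr_ge0 (lam * Z t - 1); rewrite /=; nra.
  have -> : Z t = 0.
    rewrite /Z big_seq big1// => c cin; rewrite indicE memNset// IE => tc.
    by move/negP : nUt; apply; rewrite inE /U/near_set/=; apply/hasP; exists c.
  by rewrite mulr0 expr0n mulr0 addr0.
have mZ : measurable_fun setT (fun t => (Z t)%:E).
  by apply/measurable_EFinP; apply: measurable_sum => c; exact: measurable_indic.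
have Z0 t : 0 <= Z t by apply: sumr_ge0 => c _; rewrite indicE.
have intI (A : set R) : measurable A ->
    (\int[lebesgue_measure]_t (\1_A t)%:E = lebesgue_measure A)%E.
  by move=> mA; rewrite integral_indic//; congr lebesgue_measure; exact: setIT.
have intZ : (\int[lebesgue_measure]_t (Z t)%:E = (2 * rho * (size cs)%:R)%R%:E)%E.
  under eq_integral do rewrite /Z -sumEFin.
  rewrite ge0_integral_sum//; last first.
    by move=> c; apply/measurable_EFinP; apply: measurable_indic; exact: mI.
  under eq_bigr do rewrite intI// lebesgue_measure_cball//.
  by rewrite sumEFin big_tnth sumr_const card_ord mulr_natr.
have ZE t : Z t ^+ 2 = \sum_(c <- cs) \sum_(c' <- cs) \1_(I c `&` I c') t.
  rewrite expr2 /Z big_distrlr/=; apply: eq_bigr => c _; apply: eq_bigr => c' _.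
  by rewrite indicI.
have mII c c' : measurable (I c `&` I c') by exact: measurableI.
have intZ2 : (\int[lebesgue_measure]_t (Z t ^+ 2)%:E <=
    (2 * rho * \sum_(c <- cs) \sum_(c' <- cs) (`|c - c'| <= 2 * rho)%R%:R)%R%:E)%E.
  under eq_integral do rewrite ZE -sumEFin.
  rewrite ge0_integral_sum//; last first.
  - by move=> c t _; rewrite lee_fin; apply: sumr_ge0 => ? _; rewrite indicE.
  - move=> c; apply/measurable_EFinP; apply: measurable_sum => c'.
    by apply: measurable_indic; exact: mII.
  rewrite mulr_sumr -sumEFin; apply: lee_sum => c _.
  under eq_integral do rewrite -sumEFin.
  rewrite ge0_integral_sum//; last first.
    by move=> c'; apply/measurable_EFinP; apply: measurable_indic; exact: mII.
  rewrite mulr_sumr -sumEFin; apply: lee_sum => c' _.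
  rewrite intI//.
  have [cc|cc] := leP `|c - c'| (2 * rho).
    rewrite mulr1 -(lebesgue_measure_cball c rho0).
    by apply: lebesgue_measure_mono; exact: subIsetl.
  rewrite mulr0 (_ : I c `&` I c' = set0) ?measure0//.
  apply/seteqP; split => // t [] /=; rewrite !IE => h1 h2.
  have := ler_distD t c c'; rewrite (distrC c t); lra.
have -> : ((2 * lam * (2 * rho) * (size cs)%:R)%R%:E =
    \int[lebesgue_measure]_t (2 * lam * Z t)%R%:E)%E.
  under eq_integral do rewrite EFinM.
  rewrite ge0_integralZl//= ?lee_fin ?mulr_ge0//; last first.
    by move=> t _; rewrite lee_fin; exact: Z0.
  by rewrite intZ -EFinM; congr EFin; ring.
apply: (@le_trans _ _ (\int[lebesgue_measure]_t ((\1_U t)%:E + (lam ^+ 2)%:E * (Z t ^+ 2)%:E))%E).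
  apply: ge0_le_integral_nomeas => t _; first by rewrite lee_fin !mulr_ge0 ?Z0.
  by rewrite -EFinM -EFinD lee_fin.
have mZ2 : measurable_fun setT (fun t => (Z t ^+ 2)%:E).
  by apply/measurable_EFinP; apply: measurable_funX; exact/measurable_EFinP.
rewrite ge0_integralD//; last first.
- by apply: measurable_funeM.
- by move=> t _; rewrite -EFinM lee_fin mulr_ge0// sqr_ge0.
- by apply/measurable_EFinP; exact: measurable_indic.
rewrite intI// leeD2l//.
rewrite ge0_integralZl ?lee_fin ?sqr_ge0//; last first.
  by move=> t _; rewrite lee_fin sqr_ge0.
rewrite -mulrA [leRHS]EFinM; apply: lee_wpmul2l => //.
by rewrite lee_fin sqr_ge0.
Qed.
End near_set.

(** * Random translates on the line *)

Section lipschitz_image.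
Context {R : realType}.
Local Open Scope ereal_scope.

(** A Lipschitz map expands the outer measure by at most its constant, since it
maps an interval into an interval that is at most that many times longer. *)
Lemma lebesgue_measure_lipschitz (k : R) (g : R -> R) (A : set R) :
  (0 <= k)%R -> (forall x y, (`|g x - g y| <= k * `|x - y|)%R) ->
  lebesgue_measure (g @` A) <= k%:E * lebesgue_measure A.
Proof.
move=> k0 glip.
have [k_eq0|kn0] := eqVneq k 0%R.
  have -> : lebesgue_measure (g @` A) = 0; last by rewrite k_eq0 mul0e.
  apply/eqP; rewrite eq_le measure_ge0 andbT -(@lebesgue_measure_set1 _ (g 0%R)).
  apply: lebesgue_measure_mono => _ [x _ <-]; apply/eqP; rewrite -subr_eq0 -normr_le0.
  by have := glip x 0%R; rewrite k_eq0 mul0r.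
have {k0 kn0} k0 : (0 < k)%R by rewrite lt_neqAle eq_sym kn0.
rewrite -lee_pdivrMl//.
rewrite [leRHS]/lebesgue_measure /lebesgue_stieltjes_measure /measure_extension.
apply: le_ereal_inf_tmp => _ [F [mF AF] <-].
have F0 n : 0 <= wlength idfun (F n) by exact: wlength_ge0.
rewrite lee_pdivrMl// -nneseriesZl//.
have sub : g @` A `<=` \bigcup_n (g @` F n).
  by move=> _ [x /AF[n _ Fx] <-]; exists n => //; exists x.
apply: (le_trans (lebesgue_measure_mono sub)).
apply: (le_trans (outer_measure_sigma_subadditive (mu_ext (wlength idfun)) _)).
apply: lee_nneseries => [n _ _|n _]; first exact: (measure_ge0 lebesgue_measure).
have [[a b] _ ab] := mF n; rewrite -ab.
have [lab|ba] := ltP a b; last first.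
  have -> : `]a, b]%classic = set0 :> set R by rewrite set_itv_ge// bnd_simp -leNgt.
  apply: (@le_trans _ _ 0); last first.
    by apply: mule_ge0; [rewrite lee_fin ltW|exact: wlength_ge0].
  by rewrite le_eqVlt image_set0; apply/orP; left; apply/eqP; exact: (measure0 lebesgue_measure).
rewrite /= (wlength_itv_bnd _ _ _ (ltW lab))/=.
have h0 : (0 <= k * ((b - a) / 2))%R by rewrite mulr_ge0 ?ltW// divr_gt0 ?subr_gt0.
have sub' : g @` `]a, b] `<=` `[(g ((a + b) / 2) - k * ((b - a) / 2))%R, (g ((a + b) / 2) + k * ((b - a) / 2))%R]%classic.
  move=> _ [x /= + <-]; rewrite !in_itv/= -ler_distl => /andP[ax xb].
  apply: le_trans (glip _ _) _; rewrite ler_pM2l// ler_norml; apply/andP; split; lra.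
apply: (le_trans (lebesgue_measure_mono sub')).
by rewrite lebesgue_measure_cball// -EFinM lee_fin; lra.
Qed.

Lemma lebesgue_measure_translate (c : R) (A : set R) :
  lebesgue_measure [set t | A (t - c)%R] = lebesgue_measure A.
Proof.
have trans (e : R) (B C : set R) : (forall t, C t -> B (t - e)%R) -> lebesgue_measure C <= lebesgue_measure B.
  move=> CB; have sub : C `<=` (fun t => t + e)%R @` B.
    by move=> t /CB Bt; exists (t - e)%R => //; rewrite subrK.
  apply: (le_trans (lebesgue_measure_mono sub)).
  have := @lebesgue_measure_lipschitz 1 (fun t => t + e)%R B ler01.
  rewrite mul1e; apply => x y.
  by rewrite mul1r opprD addrACA subrr addr0.
apply/eqP; rewrite eq_le; apply/andP; split; first exact: (trans c).
by apply: (trans (- c)%R) => t At /=; rewrite opprK addrK.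
Qed.

Lemma cos_lipschitz (x y : R) : (`|cos x - cos y| <= `|x - y|)%R.
Proof.
wlog xy : x y / (x <= y)%R => [h|].
  by have [/h//|/ltW/h] := leP x y; rewrite distrC (distrC y).
have [->|xny] := eqVneq x y; first by rewrite !subrr.
have {xy xny}xy : (x < y)%R by rewrite lt_neqAle xny.
have [c _ e] := MVT xy (fun z _ => is_derive_cos z) (continuous_subspaceT (@continuous_cos R)).
by rewrite distrC e normrM normrN (distrC x) ler_piMl// sin_max.
Qed.

(** The cosine is onto and non-expanding, so uniform angles do not charge a
cosine less than proportionally to length. *)
Lemma lebesgue_measure_cos (a theta : R) (B : set R) : (0 < a)%R ->
  (forall t, B t -> `|t| <= a)%R ->
  lebesgue_measure B <= a%:E * lebesgue_measure
    [set x | x \in `[theta, theta + pi]%R /\ B (a * cos (x - theta))%R].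
Proof.
move=> a0 Ba; set E := [set x | _].
have sub : B `<=` (fun x => a * cos (x - theta))%R @` E.
  move=> t Bt; have ta : (-1 <= t / a <= 1)%R.
    by rewrite -ler_norml normrM normfV (gtr0_norm a0) ler_pdivrMr// mul1r Ba.
  have ca : (a * cos (acos (t / a)) = t)%R.
    by rewrite acosK ?in_itv//= mulrCA divff ?gt_eqF// mulr1.
  exists (acos (t / a) + theta)%R; last by rewrite addrK.
  rewrite /E/= addrK ca in_itv/= lerDr acos_ge0//; split => //.
  by rewrite addrC lerD2l acos_lepi.
apply: (le_trans (lebesgue_measure_mono sub)).
apply: lebesgue_measure_lipschitz => [|x y]; first exact: ltW.
rewrite -mulrBr normrM (gtr0_norm a0) ler_pM2l//.
rewrite -[leRHS](_ : `|(x - theta) - (y - theta)| = _)%R; last by congr `|_|%R; lra.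
move: (x - theta)%R (y - theta)%R => {}x {}y.
exact: cos_lipschitz.
Qed.

Lemma measurable_xsection_pred d (U : measurableType d) (A : set (U * R)) u :
  measurable A -> measurable (fun t => A (u, t)).
Proof.
move=> /(measurable_xsection u); congr measurable.
by apply/seteqP; split => t /=; rewrite /xsection/= inE.
Qed.

Lemma measurable_cos : measurable_fun setT (@cos R).
Proof. apply: continuous_measurable_fun; exact: continuous_cos. Qed.

Lemma tonelli_sections d1 d2 (T1 : measurableType d1) (T2 : measurableType d2)
    (m1 : {sigma_finite_measure set T1 -> \bar R})
    (m2 : {sigma_finite_measure set T2 -> \bar R}) (A : set (T1 * T2)) :
  measurable A ->
  \int[m1]_x m2 (xsection A x) = \int[m2]_y m1 (ysection A y).
Proof.
move=> mA; have := indic_fubini_tonelli m1 m2 mA.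
by rewrite (indic_fubini_tonelli_FE m2 mA) (indic_fubini_tonelli_GE m1 mA).
Qed.

(** Substituting [u = t - a * cos (x - theta)], the condition is that [u] is in [S0]
and [u + 2 * a * cos (x - theta)] is in [S2]. By Tonelli it suffices to bound, for
each [u] in [S0], the measure of the angles [x] for which the latter holds;
since [S2 - u] lies in [-2 a, 2 a], this is [lebesgue_measure_cos]. *)
Lemma overlap_average (a b theta : R) (S0 S2 : set R) :
  (0 < a)%R -> (b <= a)%R -> (0 <= theta <= pi)%R ->
  measurable S0 -> measurable S2 ->
  (forall t, S0 t -> `|t| <= b)%R -> (forall t, S2 t -> `|t| <= b)%R ->
  lebesgue_measure S0 * lebesgue_measure S2 <=
  (2 * a)%:E * \int[lebesgue_measure]_(x in `[0%R, (2 * pi)%R])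
    lebesgue_measure [set t | S0 (t - a * cos (x - theta))%R /\
                              S2 (t + a * cos (x - theta))%R].
Proof.
move=> a0 ba /andP[th0 thpi] mS0 mS2 hS0 hS2.
pose mu : {sigma_finite_measure set _ -> \bar R} := (@lebesgue_measure R).
pose I : set R := `[0%R, (2 * pi)%R]%classic.
pose A : set (R * R) := [set xu | [/\ I xu.1, S0 xu.2 & S2 (xu.2 + (2 * a) * cos (xu.1 - theta))%R]].
have mshift : measurable_fun setT (fun xu : R * R => (xu.2 + (2 * a) * cos (xu.1 - theta))%R).
  apply: measurable_funD; first exact: measurable_snd.
  apply: measurable_funM => //; apply: measurableT_comp; first exact: measurable_cos.
  by apply: measurable_funB => //; exact: measurable_fst.
have mA : measurable A.
  rewrite (_ : A = (fst @^-1` I `&` snd @^-1` S0) `&`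
    (fun xu : R * R => (xu.2 + (2 * a) * cos (xu.1 - theta))%R) @^-1` S2); last first.
    by apply/seteqP; split => -[x u] /= => [[]|[[]]].
  have mI : measurable I by exact: measurable_itv.
  apply: measurableI; first apply: measurableI.
  - by rewrite -[X in measurable X]setTI; exact: measurable_fst.
  - by rewrite -[X in measurable X]setTI; exact: measurable_snd.
  - by rewrite -[X in measurable X]setTI; exact: mshift.
have dbl x (t : R) : (t + 2 * a * cos (x - theta) =
    t + a * cos (x - theta) + a * cos (x - theta))%R by ring.
have e1 : \int[lebesgue_measure]_(x in I) lebesgue_measure
      [set t | S0 (t - a * cos (x - theta))%R /\ S2 (t + a * cos (x - theta))%R] =
    \int[lebesgue_measure]_x lebesgue_measure (xsection A x).
  rewrite integral_mkcond; apply: eq_integral => x _; rewrite patchE.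
  case: ifPn => xI.
    rewrite -(lebesgue_measure_translate (- (a * cos (x - theta)))%R).
    congr lebesgue_measure; apply/seteqP; split => t /=.
      rewrite opprK addrK => -[h0 h2]; apply/xsectionP; split => //=; first exact/set_mem.
      by rewrite dbl.
    by move=> /xsectionP[/= _ h0 h2]; rewrite opprK addrK -dbl.
  rewrite (_ : xsection A x = set0) ?measure0//.
  apply/seteqP; split => // t /xsectionP[/= h _ _].
  by move: xI; rewrite notin_setE.
rewrite e1 {e1}.
have -> : \int[lebesgue_measure]_x lebesgue_measure (xsection A x) =
    \int[lebesgue_measure]_u lebesgue_measure (ysection A u).
  exact: tonelli_sections.
rewrite -ge0_integralZl//; last 2 first.
- exact: measurable_fun_ysection.
- by rewrite lee_fin mulr_ge0// ltW.
apply: (@le_trans _ _ (\int[lebesgue_measure]_u (lebesgue_measure S2 * (\1_S0 u)%:E))).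
  rewrite ge0_integralZl//; last first.
    by apply/measurable_EFinP; apply: measurable_indic; exact: mS0.
  rewrite muleC integral_indic//; apply: lee_wpmul2l => //.
  by apply: lebesgue_measure_mono => u ?; split.
apply: ge0_le_integral_nomeas => u _; first by rewrite mule_ge0 ?measure_ge0 ?lee_fin ?indicE.
rewrite indicE; have [/set_mem S0u|_] := boolP (u \in S0); last first.
  by rewrite mule0 mule_ge0 ?lee_fin ?mulr_ge0// ltW.
rewrite mule1 -(lebesgue_measure_translate (- u)%R).
apply: (le_trans (@lebesgue_measure_cos (2 * a) theta _ _ _)).
- by rewrite mulr_gt0.
- move=> t /hS2; have := hS0 _ S0u; rewrite opprK !ler_norml => /andP[? ?] /andP[? ?].
  by apply/andP; split; lra.
apply: lee_wpmul2l; first by rewrite lee_fin mulr_ge0// ltW.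
apply: lebesgue_measure_mono => x [/= + h2]; rewrite in_itv/= => /andP[x1 x2].
rewrite /ysection/= inE; split => //=; last by rewrite addrC -(opprK u).
by rewrite /I/= in_itv/=; apply/andP; split; lra.
Qed.
End lipschitz_image.

(** * Independence of disjoint families of angles *)

Section decoupling.
Context d (T : measurableType d) {R : realType} (P : probability T R).
Local Open Scope ereal_scope.

(** Independence makes the law of the pair a product measure, so Tonelli allows one
variable to be replaced by an independent copy. *)
Lemma ge0_integral_decouple d1 d2 (T1 : measurableType d1) (T2 : measurableType d2)
    (Y : {mfun T >-> T1}) (Z : {mfun T >-> T2}) (F : T1 * T2 -> \bar R) :
  (forall A B, measurable A -> measurable B ->
     P (Y @^-1` A `&` Z @^-1` B) = P (Y @^-1` A) * P (Z @^-1` B)) ->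
  measurable_fun setT F -> (forall x, 0 <= F x) ->
  \int[P]_w F (Y w, Z w) = \int[P]_w \int[P]_w' F (Y w, Z w').
Proof.
move=> indep mF F0.
have mW : measurable_fun setT (fun w => (Y w, Z w)) by exact: measurable_fun_pair.
pose W : {mfun T >-> (T1 * T2)%type} := HB.pack (fun w => (Y w, Z w)) (isMeasurableFun.Build _ _ _ _ _ mW).
have -> : \int[P]_w F (Y w, Z w) = \int[distribution P W]_x F x.
  by rewrite ge0_integral_distribution.
have -> : \int[distribution P W]_x F x = \int[distribution P Y \x distribution P Z]_x F x.
  apply: eq_measure_integral => A mA _; apply/esym.
  exact: product_measure_unique.
rewrite fubini_tonelli1// ge0_integral_distribution//; last 2 first.
- exact: measurable_fun_fubini_tonelli_F.
- by move=> x; apply: integral_ge0.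
apply: eq_integral => w _; rewrite /= /fubini_F ge0_integral_distribution//.
exact: measurableT_comp.
Qed.

End decoupling.

Section angle_space.
Context {I : choiceType} {R : realType}.

(** Cylinder sets depending on finitely many coordinates in [J]; they are closed
under intersection, which makes them suitable for uniqueness of measures. *)
Definition cylinder (J : set I) : set (set (I -> R)) :=
  [set C | exists s A, [/\ uniq s, (forall i : I, i \in s -> J i),
    (forall i : I, measurable (A i)), (forall i : I, i \notin s -> A i = [set: R]) &
    C = [set x : I -> R | forall i : I, i \in s -> A i (x i)]]].

(** All families of angles, with the sigma-algebra generated by the coordinates
in [J]. Keeping the full index set as the domain lets one describe the Cantor set by the
same formula for all [J]. *)
Definition angle_space (J : set I) := g_sigma_algebraType (cylinder J).

Lemma cylinderT J : cylinder J setT.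
Proof.
exists [::], (fun=> setT); split => //; apply/seteqP; split => //.
Qed.

Lemma cylinderI J : setI_closed (cylinder J).
Proof.
move=> _ _ [s1 [A1 [u1 J1 m1 t1 ->]]] [s2 [A2 [u2 J2 m2 t2 ->]]].
exists (undup (s1 ++ s2)), (fun i => A1 i `&` A2 i); split.
- exact: undup_uniq.
- by move=> i; rewrite mem_undup mem_cat => /orP[/J1|/J2].
- by move=> i; exact: measurableI.
- by move=> i; rewrite mem_undup mem_cat negb_or => /andP[/t1 -> /t2 ->]; rewrite setIT.
apply/seteqP; split => x /=.
  move=> [h1 h2] i _; split.
    by have [/h1//|/t1 ->] := boolP (i \in s1).
  by have [/h2//|/t2 ->] := boolP (i \in s2).
move=> h; split => i is_.
  by have [] := h i; rewrite ?mem_undup ?mem_cat ?is_.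
by have [] := h i; rewrite ?mem_undup ?mem_cat ?is_ ?orbT.
Qed.

Lemma measurable_coordinate (J : set I) i : J i ->
  measurable_fun setT (fun x : angle_space J => (x : I -> R) i).
Proof.
move=> Ji _ A mA; rewrite setTI; apply: sub_sigma_algebra.
exists [:: i], (fun j => if j == i then A else setT); split => //.
- by move=> j; rewrite inE => /eqP ->.
- by move=> j; case: ifP.
- by move=> j; rewrite inE => /negbTE ->.
apply/seteqP; split => x /= h.
  by move=> j; rewrite inE => /eqP ->; rewrite eqxx.
by have := h i (mem_head _ _); rewrite eqxx.
Qed.

End angle_space.

Section sample.
Context d (T : measurableType d) {R : realType} (P : probability T R) {I : choiceType}.
Variable X : I -> {RV P >-> R}.
Local Open Scope ereal_scope.

Definition sample_fun (J : set I) : T -> angle_space (R := R) J := fun w i => X i w.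

Lemma sample_preimage (J : set I) (s : seq I) (A : I -> set R) :
  sample_fun J @^-1` [set x : I -> R | forall i : I, i \in s -> A i (x i)] =
  \bigcap_(i in [set` s]) (X i @^-1` A i).
Proof. by apply/seteqP; split. Qed.

Lemma measurable_sample (J : set I) : measurable_fun setT (sample_fun J).
Proof.
apply: (@measurability _ _ T (angle_space J) setT (sample_fun J) (cylinder J) erefl) => _ [_ [s [A [_ _ mA _ ->]]] <-].
rewrite setTI sample_preimage; apply: fin_bigcap_measurable; first exact: finite_seq.
by move=> i _; rewrite -[X in measurable X]setTI; exact: measurable_funP.
Qed.

HB.instance Definition _ (J : set I) :=
  isMeasurableFun.Build _ _ _ _ (sample_fun J) (@measurable_sample J).

Definition sample (J : set I) : {mfun T >-> angle_space (R := R) J} := sample_fun J.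

Hypothesis X_indep : mutually_independent X.

(** Mutual independence speaks of finitely many coordinates, that is, of cylinder
sets. Both sides are finite measures in each of [A] and [B], and cylinders form a
generating class closed under intersection, so the identity extends, first in [B]
and then in [A]. *)
Lemma sample_independent (J1 J2 : set I) : (forall i, J1 i -> J2 i -> False) ->
  forall A B, measurable A -> measurable B ->
  P (sample J1 @^-1` A `&` sample J2 @^-1` B) =
  P (sample J1 @^-1` A) * P (sample J2 @^-1` B).
Proof.
move=> disj.
have cyl A B : cylinder J1 A -> cylinder J2 B ->
    P (sample J1 @^-1` A `&` sample J2 @^-1` B) =
    P (sample J1 @^-1` A) * P (sample J2 @^-1` B).
  move=> [s1 [A1 [u1 J1s m1 t1 ->]]] [s2 [A2 [u2 J2s m2 t2 ->]]].
  have s12 : uniq (s1 ++ s2).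
    rewrite cat_uniq u1 u2 andbT; apply/hasPn => i i2; apply/negP => i1.
    exact: disj (J1s _ i1) (J2s _ i2).
  have E1 i : i \in s1 -> A1 i `&` A2 i = A1 i.
    move=> i1; rewrite (t2 i) ?setIT//; apply/negP => i2.
    exact: disj (J1s _ i1) (J2s _ i2).
  have E2 i : i \in s2 -> A1 i `&` A2 i = A2 i.
    move=> i2; rewrite (t1 i) ?setTI//; apply/negP => i1.
    exact: disj (J1s _ i1) (J2s _ i2).
  rewrite !sample_preimage X_indep// X_indep//.
  have -> : \bigcap_(i in [set` s1]) (X i @^-1` A1 i) `&` \bigcap_(i in [set` s2]) (X i @^-1` A2 i)
      = \bigcap_(i in [set` s1 ++ s2]) (X i @^-1` (A1 i `&` A2 i)).
    apply/seteqP; split => w.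
      move=> [h1 h2] i /=; rewrite mem_cat => /orP[i1|i2].
        by rewrite -[_ /\ _]/((A1 i `&` A2 i) (X i w)) E1//; exact: h1.
      by rewrite -[_ /\ _]/((A1 i `&` A2 i) (X i w)) E2//; exact: h2.
    by move=> h; split => i /= is_; have := h i; rewrite /= mem_cat is_ ?orbT => /(_ isT) [].
  rewrite X_indep//; last by move=> i _; exact: measurableI.
  rewrite big_cat/=; congr (_ * _).
    by rewrite big_seq [RHS]big_seq; apply: eq_bigr => i i1; rewrite E1.
  by rewrite big_seq [RHS]big_seq; apply: eq_bigr => i i2; rewrite E2.
have mpre (J : set I) A : measurable A -> measurable (sample J @^-1` A).
  by move=> mA; rewrite -[X in measurable X]setTI; exact: measurable_funP.
have ext (J : set I) (C : set T) : measurable C ->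
    (forall A, cylinder J A -> P (sample J @^-1` A `&` C) = P (sample J @^-1` A) * P C) ->
    forall A, measurable A -> P (sample J @^-1` A `&` C) = P (sample J @^-1` A) * P C.
  move=> mC h A mA.
  have PC0 : (0 <= fine (P C))%R by rewrite fine_ge0.
  pose m1 : {measure set _ -> \bar R} := pushforward (mrestr P mC) (sample J).
  pose m2 : {measure set _ -> \bar R} := mscale (NngNum PC0) (distribution P (sample J)).
  have PC : (fine (P C))%:E = P C by rewrite fineK// fin_num_measure.
  suff : m1 (@measurable_sample J) A = m2 A.
    by rewrite /m1 /m2 /= /pushforward /mrestr /mscale /= PC muleC.
  apply: (@measure_unique _ R (angle_space J) (cylinder J) (fun=> setT) erefl (@cylinderI _ _ J)) => //.
  - by move=> _; exact: cylinderT.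
  - by apply/seteqP; split => // x _; exists 0%N.
  - move=> B cB; rewrite /m1 /m2 /= /pushforward /mrestr /mscale /= PC muleC.
    exact: h.
  - move=> _; rewrite /m1 /= /pushforward /mrestr /=.
    apply: (le_lt_trans (probability_le1 P _)) => //; last exact: ltry.
    by rewrite preimage_setT setTI.
move=> A B mA mB; apply: (ext J1) => //; first exact: mpre.
move=> A' cA'; rewrite setIC muleC; apply: (ext J2) => //.
  by apply: mpre; apply: sub_sigma_algebra.
by move=> B' cB'; rewrite setIC muleC; exact: cyl.
Qed.
End sample.

(** * Discs, centres and projections *)

Section plane_geometry.
Context {R : realType}.
Implicit Types (p q z : R * R) (r : R).

Lemma euclid_dist_ge0 p q : 0 <= euclid_dist p q.
Proof. exact: sqrtr_ge0. Qed.

Lemma euclid_distC p q : euclid_dist p q = euclid_dist q p.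
Proof. by rewrite /euclid_dist -sqrrN opprB -[X in _ + X]sqrrN opprB. Qed.

Lemma euclid_dist_le p q r : 0 <= r ->
  (euclid_dist p q <= r) = ((p.1 - q.1) ^+ 2 + (p.2 - q.2) ^+ 2 <= r ^+ 2).
Proof.
by move=> r0; rewrite -[in LHS](ger0_norm r0) -sqrtr_sqr ler_sqrt// sqr_ge0.
Qed.

Lemma euclid_dist_sqr p q :
  euclid_dist p q ^+ 2 = (p.1 - q.1) ^+ 2 + (p.2 - q.2) ^+ 2.
Proof. by rewrite sqr_sqrtr// addr_ge0// sqr_ge0. Qed.

Lemma euclid_dist_triangle q p z :
  euclid_dist p z <= euclid_dist p q + euclid_dist q z.
Proof.
rewrite euclid_dist_le ?addr_ge0 ?euclid_dist_ge0//.
have := euclid_dist_ge0 p q; have := euclid_dist_ge0 q z.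
have := euclid_dist_sqr p q; have := euclid_dist_sqr q z.
set a := euclid_dist p q; set b := euclid_dist q z.
set x1 := p.1 - q.1; set x2 := p.2 - q.2.
set y1 := q.1 - z.1; set y2 := q.2 - z.2.
have -> : p.1 - z.1 = x1 + y1 by rewrite /x1 /y1; ring.
have -> : p.2 - z.2 = x2 + y2 by rewrite /x2 /y2; ring.
move=> hb ha b0 a0.
suff : x1 * y1 + x2 * y2 <= a * b by move: ha hb; clear; nra.
apply: le_trans (ler_norm _) _.
rewrite -(ger0_norm (mulr_ge0 a0 b0)) -ler_sqr ?nnegrE// !real_normK ?num_real//.
rewrite exprMn ha hb -subr_ge0.
by rewrite [X in 0 <= X](_ : _ = (x1 * y2 - x2 * y1) ^+ 2) ?sqr_ge0//; ring.
Qed.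

Lemma proj_dir_sub theta p q :
  proj_dir theta p - proj_dir theta q = (p.1 - q.1) * cos theta + (p.2 - q.2) * sin theta.
Proof. by rewrite /proj_dir; ring. Qed.

Lemma proj_dir_lipschitz theta p q :
  `|proj_dir theta p - proj_dir theta q| <= euclid_dist p q.
Proof.
rewrite -ler_sqr ?nnegrE ?euclid_dist_ge0// real_normK ?num_real//.
rewrite euclid_dist_sqr proj_dir_sub -subr_ge0.
set a := p.1 - _; set b := p.2 - _.
rewrite [X in 0 <= X](_ : _ = (a * sin theta - b * cos theta) ^+ 2) ?sqr_ge0//.
have := cos2Dsin2 theta; set c := cos _; set s := sin _ => cs.
have -> : a ^+ 2 + b ^+ 2 = (a ^+ 2 + b ^+ 2) * (c ^+ 2 + s ^+ 2) by rewrite cs mulr1.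
by ring.
Qed.

Lemma proj_dir_unit_vec theta t : proj_dir theta (unit_vec t) = cos (t - theta) :> R.
Proof. by rewrite /proj_dir/= cosB. Qed.

Lemma proj_dirD theta p q : proj_dir theta (p + q) = proj_dir theta p + proj_dir theta q.
Proof. by rewrite /proj_dir/=; ring. Qed.

Lemma proj_dirZ theta r (p : R^o * R^o) : proj_dir theta (r *: p) = r * proj_dir theta p.
Proof. by rewrite /proj_dir /= /GRing.scale/=; ring. Qed.

(** Move from the centre along the direction [theta]. *)
Lemma disc_proj_sub theta p r t : `|t - proj_dir theta p| <= r ->
  exists2 q, euclid_dist q p <= r & proj_dir theta q = t.
Proof.
move=> tr; set d := t - proj_dir theta p.
exists (p.1 + d * cos theta, p.2 + d * sin theta).
  rewrite euclid_dist_le ?(le_trans _ tr)//= addrAC subrr add0r addrAC subrr add0r.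
  rewrite !exprMn -mulrDr cos2Dsin2 mulr1 -[leLHS]real_normK ?num_real//.
  by rewrite ler_sqr ?nnegrE// (le_trans _ tr).
rewrite /proj_dir/=.
have := cos2Dsin2 theta => cs.
transitivity (proj_dir theta p + d * (cos theta ^+ 2 + sin theta ^+ 2)).
  by rewrite /proj_dir; ring.
by rewrite cs /d; ring.
Qed.

End plane_geometry.

Section cantor_geometry.
Context {R : realType}.
Variables (r : nat -> R) (om : word -> R).
Hypothesis r_adm : admissible r.
Implicit Types (v s : word) (p q : R * R).

Let r_ge0 n : 0 <= r n. Proof. by case: r_adm => h _ _; exact: h. Qed.
Let r_dec n : r n.+1 <= r n. Proof. by case: r_adm => _ h _; exact: h. Qed.
Let r_third n : r n.+1 <= 3^-1 * r n. Proof. by case: r_adm => _ _ h; exact: h. Qed.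

Lemma radii_nonincreasing k n : (k <= n)%N -> r n <= r k.
Proof. by move/(homo_leq (r := fun x y : R => y <= x)); apply => // x y z h1 h2; exact: le_trans h2 h1. Qed.

Lemma euclid_dist_center_cons (j : 'I_4) v :
  euclid_dist (disc_center r om (j :: v)) (disc_center r om v) <= r (size v) - r (size v).+1.
Proof.
rewrite euclid_dist_le ?subr_ge0//= /GRing.scale/=.
rewrite addrAC subrr add0r addrAC subrr add0r !exprMn -mulrDr cos2Dsin2 mulr1.
exact: lexx.
Qed.

Lemma euclid_dist_center_cat s v :
  euclid_dist (disc_center r om (s ++ v)) (disc_center r om v) <=
  r (size v) - r (size (s ++ v)).
Proof.
elim: s => [|j s IH] /=.
  by rewrite subrr euclid_dist_le// !subrr expr0n addr0.
apply: le_trans (euclid_dist_triangle (disc_center r om (s ++ v)) _ _) _.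
have := euclid_dist_center_cons j (s ++ v); rewrite /=; lra.
Qed.

Lemma disc_nested s v : disc r om (s ++ v) `<=` disc r om v.
Proof.
move=> p; rewrite /disc /closed_disc/= => hp.
apply: le_trans (euclid_dist_triangle (disc_center r om (s ++ v)) _ _) _.
have := euclid_dist_center_cat s v; rewrite euclid_distC; lra.
Qed.

Lemma radii_pow n : r n <= r 0 * 3^-1 ^+ n.
Proof.
elim: n => [|n IH]; first by rewrite expr0 mulr1.
by apply: le_trans (r_third n) _; rewrite exprS mulrCA ler_pM2l ?invr_gt0.
Qed.

Lemma radii_small e : 0 < e -> exists n, r n < e.
Proof.
have q0 : (0 : R) <= 3^-1 by rewrite invr_ge0.
have q1 : (3^-1 : R) < 1 by rewrite invf_lt1// ltr1n.
move=> e0; have [n hn] := exists_pow_lt (r 0) q0 q1 e0.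
by exists n; exact: le_lt_trans (radii_pow n) hn.
Qed.

(** The level at which the construction is cut off at the scale [rho]: the discs
above it are still resolved, and its own discs are not. *)
Lemma exists_level rho : 0 < rho ->
  exists n, r n <= rho /\ forall k : nat, (k < n)%N -> rho <= r k.
Proof.
move=> rho0; have [n /ltW hn] := radii_small rho0.
have ex : exists n, r n <= rho by exists n.
case: (ex_minnP ex) => m rm hm; exists m; split => // k km.
by rewrite ltW// ltNge; apply: contraL km => /hm; rewrite leqNgt.
Qed.

(** Always choosing the letter [0] below [v] gives a nested sequence of closed
discs whose radii tend to [0]; their common point lies in the Cantor set. *)
Lemma cantor_disc_point v : exists p, cantor r om p /\ disc r om v p.
Proof.
pose c l := disc_center r om (nseq l (ord0 : 'I_4) ++ v).
pose k := size v.
have cc l m : (l <= m)%N -> euclid_dist (c m) (c l) <= r (l + k)%N - r (m + k)%N.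
  move=> lm; have := euclid_dist_center_cat (nseq (m - l) (ord0 : 'I_4)) (nseq l ord0 ++ v).
  by rewrite catA -nseqD subnK// !size_cat !size_nseq.
(* the intervals of radius r about the coordinates of the centres are nested;
   the supremum of their left ends lies in all of them *)
have coord (pr : R * R -> R) :
    (forall p q, `|pr p - pr q| <= euclid_dist p q) ->
    exists x, forall l, `|x - pr (c l)| <= r (l + k)%N.
  move=> prl; pose A := [set pr (c l) - r (l + k)%N | l in setT].
  have Aub l : ubound A (pr (c l) + r (l + k)%N).
    move=> _ [m _ <-].
    have [lm|/ltnW ml] := leqP l m.
    - have := le_trans (prl _ _) (cc _ _ lm); rewrite ler_norml => /andP[_].
      by have := r_ge0 (m + k); lra.
    - have := le_trans (prl _ _) (cc _ _ ml); rewrite ler_norml => /andP[+ _].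
      by have := r_ge0 (l + k); lra.
  have A0 : A !=set0 by exists (pr (c 0) - r (0 + k)%N), 0%N.
  exists (sup A) => l; rewrite ler_norml; apply/andP; split.
    rewrite lerBrDr addrC; apply: ub_le_sup; last by exists l.
    by exists (pr (c 0) + r (0 + k)%N); exact: Aub.
  by rewrite lerBlDr addrC; apply: ge_sup.
have [x hx] := coord _ (proj_dir_lipschitz 0).
have [y hy] := coord _ (proj_dir_lipschitz (pi / 2)).
have hP l : euclid_dist (x, y) (c l) <= 2 * r (l + k)%N.
  move: (hx l) (hy l); rewrite /proj_dir cos0 sin0 cos_pihalf sin_pihalf.
  rewrite !mulr0 !mulr1 addr0 add0r !ler_norml euclid_dist_le ?mulr_ge0//=.
  by move=> /andP[? ?] /andP[? ?]; nra.
have hPc m : euclid_dist (x, y) (c m) <= r (m + k)%N.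
  apply/ler_addgt0Pr => e e0.
  have [l0 hl0] := radii_small e0.
  pose l := maxn l0 m.
  have lm : (m <= l)%N by rewrite leq_maxr.
  apply: le_trans (euclid_dist_triangle (c l) _ _) _.
  have := hP l; have := cc _ _ lm.
  have : r (l + k)%N <= r l0.
    by apply: radii_nonincreasing; rewrite (leq_trans (leq_maxl l0 m))// leq_addr.
  lra.
have inD m : disc r om (nseq m (ord0 : 'I_4) ++ v) (x, y).
  by rewrite /disc /closed_disc/= euclid_distC size_cat size_nseq; exact: hPc.
exists (x, y); split; last exact: (inD 0).
move=> n _; have [kn|/ltnW nk] := leqP k n.
  exists (nseq (n - k) ord0 ++ v); last exact: inD.
  by rewrite /= size_cat size_nseq subnK.
exists (drop (k - n) v); first by rewrite /= size_drop subKn.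
apply: (@disc_nested (take (k - n) v)); rewrite cat_take_drop; exact: (inD 0).
Qed.

(** Two distinct vertices of a square inscribed in the unit circle are at
distance at least the square root of [2]. *)
Lemma quarter_turn (w : R) (a b : 'I_4) : a != b ->
  2 <= (cos (w + 2 * pi * a%:R / 4) - cos (w + 2 * pi * b%:R / 4)) ^+ 2 +
       (sin (w + 2 * pi * a%:R / 4) - sin (w + 2 * pi * b%:R / 4)) ^+ 2.
Proof.
pose x (n : nat) : R := if n is 0%N then 1 else if n is 2%N then -1 else 0.
pose y (n : nat) : R := if n is 1%N then 1 else if n is 3%N then -1 else 0.
have xy (j : 'I_4) : cos (2 * pi * j%:R / 4) = x j /\ sin (2 * pi * j%:R / 4) = y j.
  case: j => -[|[|[|[|//]]]] /= _.
  - by rewrite mulr0 mul0r cos0 sin0.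
  - rewrite (_ : 2 * pi * 1 / 4 = pi / 2); last by field.
    by rewrite cos_pihalf sin_pihalf.
  - rewrite (_ : 2 * pi * 2 / 4 = pi); last by field.
    by rewrite cospi sinpi.
  - rewrite (_ : 2 * pi * 3 / 4 = pi / 2 + pi); last by field.
    by rewrite cosDpi sinDpi cos_pihalf sin_pihalf oppr0.
have := cos2Dsin2 w; rewrite !cosD !sinD.
have [-> ->] := xy a; have [-> ->] := xy b.
set c := cos w; set s := sin w => cs.
have -> : (c * x a - s * y a - (c * x b - s * y b)) ^+ 2 +
    (s * x a + c * y a - (s * x b + c * y b)) ^+ 2 =
    (x a - x b) ^+ 2 + (y a - y b) ^+ 2.
  rewrite -[RHS]mul1r -cs; ring.
by case: a b => -[|[|[|[|//]]]] ? [[|[|[|[|//]]]] ?] //= _; lra.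
Qed.

Lemma siblings_apart (a b : 'I_4) v : a != b ->
  7 / 5 * (r (size v) - r (size v).+1) <=
  euclid_dist (disc_center r om (a :: v)) (disc_center r om (b :: v)).
Proof.
move=> ab; have h0 : 0 <= r (size v) - r (size v).+1 by rewrite subr_ge0.
rewrite -ler_sqr ?nnegrE ?euclid_dist_ge0 ?mulr_ge0 ?divr_ge0// euclid_dist_sqr/= /GRing.scale/=.
set h := r _ - r _.
have e (x y z : R) : x + h * y - (x + h * z) = h * (y - z) by ring.
rewrite !e exprMn [in leRHS]exprMn [X in _ + X]exprMn -mulrDr.
rewrite mulrC ler_wpM2l ?sqr_ge0//.
by apply: le_trans (quarter_turn _ ab); lra.
Qed.

(** The centres are at distance at least [7 / 5 * (2 / 3) * r k], as [7 / 5] is less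
than the square root of [2], and the two discs take away at most [2 / 3 * r k]. *)
Lemma sibling_points_apart (a b : 'I_4) v p q : a != b ->
  disc r om (a :: v) p -> disc r om (b :: v) q -> r (size v) / 4 <= euclid_dist p q.
Proof.
move=> ab; rewrite /disc /closed_disc/= => hp hq.
have := siblings_apart v ab; rewrite /= => hab.
have := euclid_dist_triangle p (disc_center r om (a :: v)) (disc_center r om (b :: v)).
have := euclid_dist_triangle q p (disc_center r om (b :: v)).
rewrite (euclid_distC q) /=.
have := r_third (size v); have := r_ge0 (size v).
lra.
Qed.

End cantor_geometry.

(** * Directions along which a vector has a small projection *)

Section angles.
Context {R : realType}.
Implicit Types (x s t delta : R) (z : R * R).

Lemma sin_ge_quarter x : 0 <= x <= pi / 2 -> x / 4 <= sin x.
Proof.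
move=> /andP[x0 xpi].
have [->|xn0] := eqVneq x 0; first by rewrite mul0r sin0.
have {x0 xn0}x0 : 0 < x by rewrite lt_neqAle eq_sym xn0.
have sinx : 0 <= sin x by apply: sin_ge0_pi; have := @pi_ge0 R; lra.
have cosx : 0 <= cos x by apply: cos_ge0_pihalf; rewrite xpi; lra.
have [c4|c4] := leP (4^-1) (cos x); last first.
  have := cos2Dsin2 x; have := @pihalf_lt2 R; nra.
have [y] := @MVT R sin cos 0 x x0 (fun y _ => is_derive_sin y)
  (continuous_subspaceT (@continuous_sin R)).
rewrite sin0 !subr0 in_itv/= => /andP[y0 yx] ->.
rewrite mulrC ler_pM2r//; apply: le_trans c4 _.
have [] := lerP (cos x) (cos y) => //.
by rewrite ltr_cos ?in_itv/=; have := @pi_ge0 R; lra.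
Qed.

Lemma norm_le_sin s : `|s| <= pi / 2 -> `|s| <= 4 * `|sin s|.
Proof.
move=> spi.
have -> : `|sin s| = sin `|s|.
  have h : 0 <= sin `|s| by apply: sin_ge0_pi; rewrite normr_ge0/=; have := @pi_ge0 R; lra.
  by have [s0|s0] := lerP 0 s; move: h; [rewrite ger0_norm// => /ger0_norm
    |rewrite ltr0_norm// sinN => /ger0_norm; rewrite normrN].
have := @sin_ge_quarter `|s|; rewrite normr_ge0 spi => /(_ isT); lra.
Qed.

Definition slab_angles delta z : set R :=
  [set t | t \in `[0, pi]] `&` [set t | `|proj_dir t z| <= delta].

(** If the projections of [z] in the directions [t0] and [t] are both at most [delta], then
[sin (t - t0)] is [O(delta / |z|)]: expand [|z|^2 sin (t - t0)] in terms of the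
projections of [z] and of its quarter turn. Hence [t] is close to [t0] modulo [pi]. *)
Lemma slab_angles_sub delta z t0 : 0 < euclid_dist z (0, 0) -> slab_angles delta z t0 ->
  slab_angles delta z `<=`
    let e := 8 * delta / euclid_dist z (0, 0) in
    `[t0 - e, t0 + e] `|` `[t0 - pi - e, t0 - pi + e] `|` `[t0 + pi - e, t0 + pi + e].
Proof.
set N := euclid_dist z (0, 0) => N0 [/= /[!in_itv]/= /andP[t00 t0pi] ht0].
move=> t [/= /[!in_itv]/= /andP[t_ge0 tpi] ht].
have delta0 : 0 <= delta by apply: le_trans ht.
have N2 : N ^+ 2 = z.1 ^+ 2 + z.2 ^+ 2 by rewrite euclid_dist_sqr !subr0.
have key : N * `|sin (t - t0)| <= 2 * delta.
  have dN u : `|- z.1 * sin u + z.2 * cos u| <= N.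
    rewrite -ler_sqr ?nnegrE ?(ltW N0)// real_normK ?num_real// N2 -subr_ge0.
    have := cos2Dsin2 u => cs.
    have -> : z.1 ^+ 2 + z.2 ^+ 2 = (z.1 ^+ 2 + z.2 ^+ 2) * (cos u ^+ 2 + sin u ^+ 2).
      by rewrite cs mulr1.
    by rewrite [X in 0 <= X](_ : _ = (z.1 * cos u + z.2 * sin u) ^+ 2) ?sqr_ge0//; ring.
  have e : N ^+ 2 * sin (t - t0) = proj_dir t z * (- z.1 * sin t0 + z.2 * cos t0)
     - (- z.1 * sin t + z.2 * cos t) * proj_dir t0 z.
    by rewrite N2 sinB /proj_dir; ring.
  have : N ^+ 2 * `|sin (t - t0)| <= delta * N + N * delta.
    rewrite -[X in X * _]ger0_norm ?sqr_ge0// -normrM e.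
    apply: le_trans (ler_normB _ _) _; rewrite !normrM.
    by apply: lerD; apply: ler_pM.
  by rewrite expr2 -mulrA [delta * N]mulrC -mulrDr ler_pM2l//; lra.
have sub u : `|u| <= pi / 2 -> `|sin u| = `|sin (t - t0)| -> `|u| <= 8 * delta / N.
  move=> /norm_le_sin h e; rewrite ler_pdivlMr// mulrC.
  apply: le_trans (ler_wpM2l (ltW N0) h) _; rewrite e; lra.
rewrite /=; set e := 8 * delta / N.
have [h|] := leP `|t - t0| (pi / 2).
  have := sub _ h erefl; rewrite ler_norml => /andP[h1 h2].
  by left; left; apply/andP; split; rewrite /e; lra.
rewrite ltr_normr => /orP[h|h].
  have hu : `|t - t0 - pi| <= pi / 2 by rewrite ler_norml; apply/andP; split; lra.
  have := sub _ hu; rewrite -[in sin (t - t0)](subrK pi (t - t0)) sinDpi normrN => /(_ erefl).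
  rewrite ler_norml => /andP[h1 h2].
  by right; apply/andP; split; rewrite /e; lra.
have hu : `|t - t0 + pi| <= pi / 2 by rewrite ler_norml; apply/andP; split; lra.
have := sub _ hu; rewrite sinDpi normrN => /(_ erefl).
rewrite ler_norml => /andP[h1 h2].
by left; right; apply/andP; split; rewrite /e; lra.
Qed.

Lemma measurable_proj_dir z : measurable_fun setT (fun t => proj_dir t z).
Proof.
apply: continuous_measurable_fun => t; rewrite /proj_dir.
by apply: cvgD; apply: cvgM; try exact: cvg_cst; [exact: continuous_cos|exact: continuous_sin].
Qed.

Lemma measurable_slab_angles delta z : measurable (slab_angles delta z).
Proof.
apply: measurableI; first exact: measurable_itv.
rewrite [X in measurable X](_ : _ = (fun t => `|proj_dir t z|) @^-1` `]-oo, delta]).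
  rewrite -[X in measurable X]setTI; apply: measurableT_comp => //.
  exact: measurable_proj_dir.
by apply/seteqP; split => t /=; rewrite in_itv.
Qed.

Lemma slab_angles_measure delta z : 0 < euclid_dist z (0, 0) -> 0 <= delta ->
  (lebesgue_measure (slab_angles delta z) <= (48 * delta / euclid_dist z (0, 0))%:E)%E.
Proof.
move=> N0 d0; have [->|/set0P[t0 ht0]] := eqVneq (slab_angles delta z) set0.
  by rewrite measure0 lee_fin divr_ge0 ?mulr_ge0// ltW.
have := slab_angles_sub N0 ht0; rewrite /=; set e := 8 * _ / _ => sub.
have e0 : 0 <= e by rewrite divr_ge0 ?mulr_ge0// ltW.
apply: (le_trans (lebesgue_measure_mono sub)).
apply: (le_trans (lebesgue_measureU2 _ _)).
apply: (le_trans (leeD2r _ (lebesgue_measureU2 _ _))).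
rewrite !lebesgue_measure_cball// -!EFinD lee_fin /e; lra.
Qed.

Lemma slab_angles_measure_pi delta z :
  (lebesgue_measure (slab_angles delta z) <= pi%:E)%E.
Proof.
have : slab_angles delta z `<=` `[0, pi] by move=> t [].
move/lebesgue_measure_mono => /le_trans; apply.
by rewrite lebesgue_measure_itv/= lte_fin pi_gt0 oppr0 adde0.
Qed.
End angles.

(** * Lower bound for the Favard length *)

Section favard_energy.
Context {R : realType}.
Local Open Scope ereal_scope.

Lemma measurable_near_proj (rho : R) (ps : seq (R * R)) :
  measurable_fun setT (fun t : R =>
    lebesgue_measure (near_set rho [seq proj_dir t p | p <- ps])).
Proof.
have mA : measurable [set ut : R * R |
    near_set rho [seq c ut.1 | c <- [seq (fun t => proj_dir t p) | p <- ps]] ut.2].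
  apply: measurable_near_set => c; elim: ps => //= p ps IH [<-|//].
  exact: measurable_proj_dir.
have := measurable_fun_xsection lebesgue_measure mA.
congr (measurable_fun _ _); apply/funext => t /=; congr lebesgue_measure.
by apply/seteqP; split => s /=; rewrite /xsection/= inE/= -map_comp.
Qed.

(** Integrate the second moment bound over the directions: a pair of points
contributes the measure of the directions in which the two project within [2 rho]
of each other. *)
Lemma Fav_energy (E : set (R * R)) (ps : seq (R * R)) (rho lam : R) :
  (0 <= rho)%R -> (0 <= lam)%R ->
  (forall p q, p \in ps -> (euclid_dist q p <= rho)%R -> E q) ->
  (2 * lam * (2 * rho) * (size ps)%:R * pi)%:E <=
  Fav E + (lam ^+ 2 * (2 * rho))%:E *
    \sum_(p <- ps) \sum_(q <- ps) lebesgue_measure (slab_angles (2 * rho) (p - q)%R).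
Proof.
move=> rho0 lam0 hE.
pose C := (2 * lam * (2 * rho) * (size ps)%:R)%R.
pose D : set R := `[0%R, pi]%classic.
have mD : measurable D by exact: measurable_itv.
have intD (A : set R) : measurable A ->
    \int[lebesgue_measure]_(t in D) (\1_A t)%:E = lebesgue_measure (A `&` D).
  by move=> mA; rewrite integral_indic.
have -> : (C * pi)%:E = \int[lebesgue_measure]_(t in D) C%:E.
  have lD : lebesgue_measure D = pi%:E.
    by rewrite /D lebesgue_measure_itv/= lte_fin pi_gt0 oppr0 adde0.
  by rewrite integral_cst// EFinM; congr (_ * _); exact: esym lD.
pose S (t : R) : R := (\sum_(p <- ps) \sum_(q <- ps) \1_(slab_angles (2 * rho) (p - q)) t)%R.
pose L (t : R) := lebesgue_measure (near_set rho [seq proj_dir t p | p <- ps]).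
have mL : measurable_fun D L by apply: measurable_funTS; exact: measurable_near_proj.
have mslab (p q : R * R) : measurable (slab_angles (2 * rho) (p - q)%R).
  exact: measurable_slab_angles.
have S0 t : (0 <= S t)%R.
  by apply: sumr_ge0 => ? _; apply: sumr_ge0 => ? _; rewrite indicE.
apply: (@le_trans _ _ (\int[lebesgue_measure]_(t in D) (L t + (lam ^+ 2 * (2 * rho) * S t)%:E))).
  apply: ge0_le_integral_nomeas => t Dt; first by rewrite lee_fin !mulr_ge0.
  have := near_set_energy [seq proj_dir t p | p <- ps] rho0 lam0.
  rewrite size_map big_map; congr (_ <= _ + (_ * _)%:E).
  apply: eq_bigr => p _; rewrite big_map; apply: eq_bigr => q _.
  rewrite proj_dir_sub indicE; congr (nat_of_bool _)%:R.
  by apply/idP/idP => [h|/set_mem[]//]; rewrite inE; split.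
rewrite (@ge0_integralD _ _ _ lebesgue_measure D mD L)//; last 2 first.
- by move=> t _; rewrite lee_fin !mulr_ge0 ?sqr_ge0.
- apply/measurable_EFinP; apply: measurable_funM => //.
  apply: measurable_sum => p; apply: measurable_sum => q.
  apply: measurable_indic; exact: mslab.
apply: leeD.
  apply: ge0_le_integral_nomeas => t Dt; first exact: measure_ge0.
  apply: lebesgue_measure_mono => s; rewrite /near_set/= => /hasP[_ /mapP[p pps ->]].
  by move=> /disc_proj_sub[q qp <-]; exists q => //; exact: hE qp.
under eq_integral do rewrite EFinM.
rewrite ge0_integralZl//; last 3 first.
- apply/measurable_EFinP.
  apply: measurable_sum => p; apply: measurable_sum => q.
  apply: measurable_indic; exact: mslab.
- by move=> t _; rewrite lee_fin.
- by rewrite lee_fin !mulr_ge0 ?sqr_ge0.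
apply: lee_wpmul2l; first by rewrite lee_fin !mulr_ge0 ?sqr_ge0.
under eq_integral do rewrite /S -sumEFin.
rewrite ge0_integral_sum//; last 2 first.
- move=> p; apply/measurable_EFinP; apply: measurable_sum => q.
  apply: measurable_indic; exact: mslab.
- by move=> p t _; rewrite lee_fin; apply: sumr_ge0 => ? _; rewrite indicE.
apply: lee_sum => p _; under eq_integral do rewrite -sumEFin.
rewrite ge0_integral_sum//; last first.
  by move=> q; apply/measurable_EFinP; apply: measurable_indic; exact: mslab.
apply: lee_sum => q _; rewrite intD//; first exact: lebesgue_measure_mono.
Qed.

End favard_energy.

Section favard_lower_bound.
Context {R : realType}.
Variables (r : nat -> R) (om : word -> R).
Hypothesis r_adm : admissible r.
Implicit Types (v : word) (p q : R * R).

Let pt v := projT1 (cid (cantor_disc_point om r_adm v)).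

Let ptP v : cantor r om (pt v) /\ disc r om v (pt v).
Proof. by rewrite /pt; case: cid. Qed.

Fixpoint leaf_points (m : nat) v : seq (R * R) :=
  if m is m'.+1 then flatten [seq leaf_points m' (j :: v) | j <- enum 'I_4]
  else [:: pt v].

Lemma size_leaf_points m v : size (leaf_points m v) = (4 ^ m)%N.
Proof.
elim: m v => [//|m IH] v /=.
rewrite size_flatten /shape -map_comp sumnE big_map big_enum/=.
under eq_bigr do rewrite IH.
by rewrite sum_nat_const card_ord expnS.
Qed.

Lemma leaf_points_cantor m v p : p \in leaf_points m v -> cantor r om p /\ disc r om v p.
Proof.
elim: m v => [|m IH] v /=; first by rewrite inE => /eqP ->; exact: ptP.
move=> /flattenP[_ /mapP[j _ ->]] /IH[Kp Dp]; split => //.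
exact: (@disc_nested _ r om r_adm [:: j] v).
Qed.

Lemma sumr_const_seq (T : Type) (s : seq T) (x : R) :
  \sum_(i <- s) x = (size s)%:R * x.
Proof. by rewrite big_tnth sumr_const card_ord mulr_natl. Qed.

(** Induction on the depth. The pairs in a common child are covered by the
induction hypothesis; those in distinct children are at distance at least
[r k / 4], so each contributes at most [48 * (2 rho) / (r k / 4) = 384 * rho / r k].
Pairs in a common disc of the last level contribute at most the whole range [pi]. *)
Lemma leaf_energy (rho C : R) n m v : 0 < rho -> 384 <= C -> (size v + m)%N = n ->
  (forall k : nat, (k < n)%N -> 0 < r k) ->
  (\sum_(p <- leaf_points m v) \sum_(q <- leaf_points m v)
     lebesgue_measure (slab_angles (2 * rho) (p - q)%R) <=
   (C * rho * 16 ^+ m * 4 ^+ size v *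
    (\sum_(size v <= j < n) 4^-1 ^+ j / r j + 4^-1 ^+ n / rho))%R%:E)%E.
Proof.
move=> rho0 C384; have C0 : 0 <= C by lra.
elim: m v => [|m IH] v /=.
  rewrite addn0 => <- rpos; rewrite !big_seq1 big_geq// add0r expr0 mulr1.
  apply: le_trans (slab_angles_measure_pi _ _) _; rewrite lee_fin.
  rewrite [leRHS](_ : _ = C); first by have := @pihalf_lt2 R; lra.
  by rewrite exprVn; field; rewrite gt_eqF//= expf_neq0.
move=> vn rpos.
have vltn : (size v < n)%N by rewrite -vn -addSnnS leq_addr.
have rv := rpos _ vltn.
set X := C * rho * 16 ^+ m * 4 ^+ (size v).+1 *
    (\sum_((size v).+1 <= j < n) 4^-1 ^+ j / r j + 4^-1 ^+ n / rho).
pose Y := 16 ^+ m * (C * rho / r (size v)).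
rewrite big_flatten big_map big_enum.
have key (a b : 'I_4) : (\sum_(p <- leaf_points m (a :: v)) \sum_(q <- leaf_points m (b :: v))
     lebesgue_measure (slab_angles (2 * rho) (p - q)%R) <= ((a == b)%:R * X + Y)%:E)%E.
  have Y0 : 0 <= Y.
    by rewrite /Y mulr_ge0// ?exprn_ge0// divr_ge0// ?mulr_ge0// ltW.
  have [->|ab] := eqVneq a b.
    have := IH (b :: v); rewrite /= addSnnS => /(_ vn rpos)/le_trans; apply.
    by rewrite lee_fin mul1r lerDl.
  rewrite mul0r add0r.
  have -> : Y = \sum_(p <- leaf_points m (a :: v)) \sum_(q <- leaf_points m (b :: v)) (C * rho / r (size v)).
    rewrite !sumr_const_seq !size_leaf_points mulrA -natrM -expnMn.
    by rewrite natrX.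
  rewrite big_seq [in leRHS]big_seq -sumEFin; apply: lee_sum => p pa.
  rewrite big_seq [in leRHS]big_seq -sumEFin; apply: lee_sum => q qb.
  have [_ Dp] := leaf_points_cantor pa; have [_ Dq] := leaf_points_cantor qb.
  have pq := sibling_points_apart r_adm ab Dp Dq.
  have e0 : euclid_dist (p - q) (0, 0) = euclid_dist p q.
    by rewrite /euclid_dist/= !subr0.
  have N0 : 0 < euclid_dist (p - q) (0, 0).
    by rewrite e0; apply: lt_le_trans pq; rewrite divr_gt0.
  apply: le_trans (slab_angles_measure N0 _) _; first by rewrite mulr_ge0// ltW.
  rewrite lee_fin e0 ler_pdivrMr -?e0// e0 mulrAC.
  rewrite ler_pdivlMr//.
  have h1 : C * rho * (r (size v) / 4) <= C * rho * euclid_dist p q.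
    by apply: ler_wpM2l => //; rewrite mulr_ge0// ltW.
  have h2 : 384 * (rho * (r (size v) / 4)) <= C * (rho * (r (size v) / 4)).
    by apply: ler_wpM2r => //; rewrite mulr_ge0 ?divr_ge0 ?ltW.
  by move: h1 h2; clear; lra.
apply: (@le_trans _ _ (\sum_(a : 'I_4) \sum_(b : 'I_4) ((a == b)%:R * X + Y))%:E).
  rewrite -sumEFin; apply: lee_sum => a _.
  under eq_bigr do rewrite big_flatten big_map big_enum.
  by rewrite exchange_big/= -sumEFin; apply: lee_sum => b _; exact: key.
rewrite lee_fin.
have -> : \sum_(a : 'I_4) \sum_(b : 'I_4) ((a == b)%:R * X + Y) = 4 * X + 16 * Y.
  by rewrite !big_ord_recl !big_ord0/=; ring.
rewrite [in leRHS]big_ltn// /X /Y; set S := \sum_(_ <= _ < _) _.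
rewrite (exprS 16) (exprS 4) le_eqVlt; apply/predU1P; left.
have q4 : 4 ^+ size v * 4^-1 ^+ size v = 1 :> R by rewrite -exprMn divff// expr1n.
set q := 4 ^+ size v in q4 *; set q' := 4^-1 ^+ size v in q4 *.
set u := 4^-1 ^+ n / rho.
transitivity (C * rho * (16 * 16 ^+ m) * q * (S + u) + 16 * 16 ^+ m * (C * rho / r (size v)) * (q * q')).
  by rewrite q4; ring.
by ring.
Qed.

Lemma Fav_cantor_lower_bound (rho : R) n : 0 < rho -> r n <= rho ->
  (forall k : nat, (k < n)%N -> rho <= r k) ->
  ((48^-1 / energy r n rho)%:E <= Fav (neighborhood (cantor r om) rho))%E.
Proof.
move=> rho0 rn hr.
have rpos (k : nat) : (k < n)%N -> 0 < r k by move=> /hr; exact: lt_le_trans.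
have L0 : 0 < energy r n rho.
  rewrite /energy ltr_wpDl ?divr_gt0 ?exprn_gt0 ?invr_gt0//.
  by apply: sumr_ge0 => k _; rewrite divr_ge0 ?exprn_ge0// ltW// rpos.
(* the constant is kept abstract: only its value against [pi] matters at the end *)
have [C C384] : exists C : R, C = 384 by exists 384.
have C0 : 0 < C by rewrite C384 ltr0n.
(* this [lam] maximizes the quadratic polynomial in the bound below *)
pose lam := pi / (C * rho * 4 ^+ n * energy r n rho).
have q0 : 0 < 4 ^+ n :> R by rewrite exprn_gt0.
have lam0 : 0 <= lam.
  by rewrite divr_ge0 ?pi_ge0 ?mulr_ge0 ?ltW.
have hE p q : p \in leaf_points n [::] -> euclid_dist q p <= rho ->
    neighborhood (cantor r om) rho q.
  move=> /leaf_points_cantor[Kp _] qp; rewrite /neighborhood/= /dist_to_set.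
  apply: (@le_trans _ _ (euclid_dist q p)%:E); last by rewrite lee_fin.
  by apply: ereal_inf_lbound; exists p.
have := Fav_energy (ltW rho0) lam0 hE.
rewrite size_leaf_points natrX.
have := leaf_energy rho0 _ (erefl (size ([::] : word) + n)%N).
move/(_ C); rewrite {1}C384 lexx => /(_ isT rpos)/=.
rewrite expr0 mulr1 big_mkord -/(energy r n rho).
set F := Fav _; set S := (\sum_(p <- _) _)%E => hS hF.
have {hF} : ((2 * lam * (2 * rho) * 4 ^+ n * pi)%:E <= F + (lam ^+ 2 * (2 * rho) * (C * rho * 16 ^+ n * energy r n rho))%:E)%E.
  apply: le_trans hF _; apply: leeD2l; rewrite EFinM; apply: lee_wpmul2l hS.
  by rewrite lee_fin mulr_ge0 ?sqr_ge0// mulr_ge0 ?ltW.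
rewrite -leeBlDr// -EFinB; apply: le_trans; rewrite lee_fin.
have -> : 2 * lam * (2 * rho) * 4 ^+ n * pi - lam ^+ 2 * (2 * rho) * (C * rho * 16 ^+ n * energy r n rho)
   = 2 * pi ^+ 2 / C / energy r n rho.
  rewrite /lam (_ : 16 = 4 * 4 :> R) ?exprMn; last by ring.
  by field; rewrite !gt_eqF.
rewrite ler_pM2r ?invr_gt0// C384; have := @pi_ge2 R; nra.
Qed.

End favard_lower_bound.

(** * The projection of a neighbourhood, level by level *)

Section hits.
Context {R : realType}.
Variables (r : nat -> R) (h : R).
Implicit Types (om : word -> R) (v s : word) (theta t : R).

(** [hits theta m om v] is the projection, seen from the centre of the disc of
[v], of the [h]-neighbourhood of the centres [m] levels further down. The
recursion exhibits it as a union of four translates, one for each child of [v],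
and only the angle at [v] enters the translations. *)
Fixpoint hits theta m om v : set R :=
  if m is m'.+1 then
    [set t | exists j : 'I_4, hits theta m' om (j :: v)
       (t - (r (size v) - r (size v).+1) * cos (om v + 2 * pi * j%:R / 4 - theta))]
  else [set t | `|t| <= h].

Lemma hits_path theta m om s v t : size s = m ->
  `|t - (proj_dir theta (disc_center r om (s ++ v)) - proj_dir theta (disc_center r om v))| <= h ->
  hits theta m om v t.
Proof.
elim: m s v t => [|m IH] s v t.
  by move/size0nil => ->; rewrite subrr subr0.
case/lastP: s => [//|s j]; rewrite size_rcons => -[sm] ht.
exists j; apply: (IH s) => //; move: ht; rewrite cat_rcons; congr (`|_| <= _).
rewrite [in RHS]/= proj_dirD proj_dirZ proj_dir_unit_vec.
ring.
Qed.

Hypothesis r_adm : admissible r.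
Hypothesis h_ge0 : 0 <= h.

Lemma hits_bounded theta m om v t : hits theta m om v t ->
  `|t| <= r (size v) - r (size v + m)%N + h.
Proof.
elim: m v t => [|m IH] v t /=; first by rewrite addn0 subrr add0r.
move=> [j /IH] /=; rewrite addSnnS.
set a := r (size v) - r (size v).+1; set x := cos _ => ht.
have a0 : 0 <= a by rewrite subr_ge0; case: r_adm.
have : `|a * x| <= a by rewrite normrM (ger0_norm a0) ler_piMr// cos_max.
have := ler_normD (t - a * x) (a * x); rewrite subrK.
by move: ht; rewrite /a; clear; lra.
Qed.

Lemma measurable_hits d (U : measurableType d) (th : U -> R) m (om : U -> word -> R) v :
  measurable_fun setT th ->
  (forall s, (size s < m)%N -> measurable_fun setT (fun x => om x (s ++ v))) ->
  measurable [set xt : U * R | hits (th xt.1) m (om xt.1) v xt.2].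
Proof.
move=> mth; elim: m v => [|m IH] v mom.
  rewrite [X in measurable X](_ : _ = (fun xt : U * R => `|xt.2|) @^-1` `]-oo, h]).
    have mn : measurable_fun setT (fun xt : U * R => `|xt.2|).
      by apply: measurableT_comp => //; exact: measurable_snd.
    by rewrite -[X in measurable X]setTI; apply: mn => //; exact: measurable_itv.
  by apply/seteqP; split => xt /=; rewrite in_itv.
pose g (j : 'I_4) (xt : U * R) := (xt.1, xt.2 - (r (size v) - r (size v).+1) *
  cos (om xt.1 v + 2 * pi * j%:R / 4 - th xt.1)).
rewrite [X in measurable X](_ : _ = \bigcup_(j in [set: 'I_4])
   (g j @^-1` [set xt : U * R | hits (th xt.1) m (om xt.1) (j :: v) xt.2])); last first.
  by apply/seteqP; split => xt /= => [[j]|[j _]]; exists j.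
apply: fin_bigcup_measurable; first exact: finite_finset.
move=> j _; have mg : measurable_fun setT (g j).
  apply: measurable_fun_pair; first exact: measurable_fst.
  apply: measurable_funB; first exact: measurable_snd.
  apply: measurable_funM => //; apply: measurableT_comp; first exact: measurable_cos.
  have m1 : measurable_fun setT (fun xt : U * R => om xt.1 v).
    by apply: (measurableT_comp (mom [::] _)) => //; exact: measurable_fst.
  apply: measurable_funB; last by apply: measurableT_comp => //; exact: measurable_fst.
  by apply: measurable_funD.
rewrite -[X in measurable X]setTI; apply: mg => //.
apply: IH => s sm; have := mom (rcons s j); rewrite size_rcons cat_rcons; exact.
Qed.

Lemma measurable_hits_length d (U : measurableType d) (th : U -> R) m (om : U -> word -> R) v :
  measurable_fun setT th ->
  (forall s, (size s < m)%N -> measurable_fun setT (fun x => om x (s ++ v))) ->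
  measurable_fun setT (fun x => lebesgue_measure (hits (th x) m (om x) v)).
Proof.
move=> mth mom; have := measurable_fun_xsection (@lebesgue_measure R) (measurable_hits mth mom).
congr (measurable_fun _ _); apply/funext => x /=; congr lebesgue_measure.
by apply/seteqP; split => t /=; rewrite /xsection/= inE.
Qed.

Lemma measurable_hits_set theta m om v : measurable (hits theta m om v).
Proof.
have mth : measurable_fun setT (fun _ : R => theta) by exact: measurable_cst.
have mom s : (size s < m)%N -> measurable_fun setT (fun _ : R => om (s ++ v)) by move=> _; exact: measurable_cst.
exact: measurable_xsection_pred (0 : R) (measurable_hits mth mom).
Qed.

(** A point within [rho] of the Cantor set is within [2 rho] of one of its points, as
the distance is an infimum, and that point is within [r n] of a centre. *)
Lemma proj_neighborhood_hits theta om n (rho : R) : 0 < rho -> r n + 2 * rho = h ->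
  proj_dir theta @` neighborhood (cantor r om) rho `<=` hits theta n om [::].
Proof.
move=> rho0 hE _ [x + <-]; rewrite /neighborhood/= /dist_to_set => hx.
have [y Ky xy] : exists2 y, cantor r om y & euclid_dist x y <= 2 * rho.
  apply: contrapT => /forall2NP hn.
  have : ((2 * rho)%:E <= ereal_inf [set (euclid_dist x y)%:E | y in cantor r om])%E.
    apply: le_ereal_inf_tmp => _ [y Ky <-]; rewrite lee_fin leNgt; apply/negP => /ltW xy.
    by have [|] := hn y.
  by move=> /le_trans/(_ hx); rewrite lee_fin; lra.
have [i /= ni Di] := Ky n I.
apply: (hits_path (s := i)) => //; rewrite cats0/=.
have -> : proj_dir theta (0, 0) = 0 by rewrite /proj_dir !mul0r addr0.
rewrite subr0 -hE.
apply: le_trans (proj_dir_lipschitz _ _ _) _.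
apply: le_trans (euclid_dist_triangle y _ _) _.
move: Di; rewrite /disc /closed_disc/= ni euclid_distC => Di.
by rewrite addrC lerD.
Qed.

Lemma hits_length_le theta m om v :
  (lebesgue_measure (hits theta m om v) <= (2 * (r (size v) - r (size v + m)%N + h))%:E)%E.
Proof.
have b0 : 0 <= r (size v) - r (size v + m)%N + h.
  by rewrite addr_ge0// subr_ge0; apply: radii_nonincreasing => //; rewrite leq_addr.
rewrite -(lebesgue_measure_cball 0 b0); apply: lebesgue_measure_mono => t /hits_bounded.
by rewrite /= in_itv/= sub0r add0r ler_norml.
Qed.

(** The children [0] and [2] lie opposite each other on a circle about the centre of
[v], so their projections are translated by opposite amounts; [x] stands for the
angle at [v], which is thereby decoupled from the angles [om] inside the children. *)
Definition opposite_overlap theta m om v (x : R) : set R :=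
  let a := r (size v) - r (size v).+1 in
  [set t | hits theta m om ((inord 0 : 'I_4) :: v) (t - a * cos (x - theta)) /\
           hits theta m om ((inord 2 : 'I_4) :: v) (t + a * cos (x - theta))].

(** Inclusion-exclusion for one pair of opposite children, the union bound for the rest. *)
Lemma hits_length_step theta m om v :
  (lebesgue_measure (hits theta m.+1 om v) +
     lebesgue_measure (opposite_overlap theta m om v (om v)) <=
   lebesgue_measure (hits theta m om ((inord 0 : 'I_4) :: v)) +
   lebesgue_measure (hits theta m om ((inord 2 : 'I_4) :: v)) +
   (lebesgue_measure (hits theta m om ((inord 1 : 'I_4) :: v)) +
    lebesgue_measure (hits theta m om ((inord 3 : 'I_4) :: v))))%E.
Proof.
set a := r (size v) - r (size v).+1.
pose S (j : 'I_4) : set R := [set t | hits theta m om (j :: v)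
   (t - a * cos (om v + 2 * pi * j%:R / 4 - theta))].
have lS j : lebesgue_measure (S j) = lebesgue_measure (hits theta m om (j :: v)).
  exact: lebesgue_measure_translate.
have mS j : measurable (S j).
  rewrite (_ : S j = (fun t => t - a * cos (om v + 2 * pi * j%:R / 4 - theta)) @^-1`
    hits theta m om (j :: v))//.
  have mt : measurable_fun setT (fun t => t - a * cos (om v + 2 * pi * j%:R / 4 - theta)).
    by apply: measurable_funB.
  rewrite -[X in measurable X]setTI; apply: mt => //; exact: measurable_hits_set.
have e0 : om v + 2 * pi * (inord 0 : 'I_4)%:R / 4 - theta = om v - theta.
  by rewrite inordK// mulr0 mul0r addr0.
have e2 : cos (om v + 2 * pi * (inord 2 : 'I_4)%:R / 4 - theta) = - cos (om v - theta).
  by rewrite inordK// -cosDpi; congr cos; field.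
have SE : hits theta m.+1 om v = (S (inord 0) `|` S (inord 2)) `|` (S (inord 1) `|` S (inord 3)).
  apply/seteqP; split => t /=.
    move=> [j]; rewrite -/(S j t).
    have : j \in [:: inord 0; inord 1; inord 2; inord 3 : 'I_4].
      by case: j => -[|[|[|[|//]]]] ?; rewrite !inE -!val_eqE/= !inordK.
    rewrite !inE => /or4P[]/eqP ->; by [left; left|right; left|left; right|right; right].
  by move=> [[]|[]] ?; [exists (inord 0)|exists (inord 2)|exists (inord 1)|exists (inord 3)].
have OE : opposite_overlap theta m om v (om v) = S (inord 0) `&` S (inord 2).
  apply/seteqP; split => t /=; rewrite /S/= e0 e2 mulrN opprK//.
rewrite SE OE -!lS.
apply: (@le_trans _ _ ((lebesgue_measure (S (inord 0) `|` S (inord 2)) + lebesgue_measure (S (inord 1) `|` S (inord 3))) +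
   lebesgue_measure (S (inord 0) `&` S (inord 2)))%E).
  by apply: leeD2r; exact: lebesgue_measureU2.
rewrite addeAC lebesgue_measureUI//; apply: leeD2l; exact: lebesgue_measureU2.
Qed.

Lemma opposite_overlap_average theta m om v : 0 <= theta <= pi ->
  0 < r (size v) - r (size v).+1 ->
  r (size v).+1 - r (size v + m.+1)%N + h <= r (size v) - r (size v).+1 ->
  (lebesgue_measure (hits theta m om ((inord 0 : 'I_4) :: v)) *
   lebesgue_measure (hits theta m om ((inord 2 : 'I_4) :: v)) <=
  (2 * (r (size v) - r (size v).+1))%:E *
   \int[lebesgue_measure]_(x in `[0%R, (2 * pi)%R])
      lebesgue_measure (opposite_overlap theta m om v x))%E.
Proof.
move=> th a0 ba; apply: overlap_average ba _ _ _ _ _ => //.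
- exact: measurable_hits_set.
- exact: measurable_hits_set.
- by move=> t /hits_bounded; rewrite /= addSnnS.
- by move=> t /hits_bounded; rewrite /= addSnnS.
Qed.

End hits.

Lemma measurable_opposite_overlap {R : realType} (r : nat -> R) (h theta : R) d
    (U : measurableType d) m (om : U -> word -> R) (y : U -> R) v :
  measurable_fun setT y ->
  (forall s, s != [::] -> measurable_fun setT (fun x => om x (s ++ v))) ->
  measurable_fun setT (fun x =>
    lebesgue_measure (opposite_overlap r h theta m (om x) v (y x))).
Proof.
move=> my mom; set a := r (size v) - r (size v).+1.
pose g (e : R) (xt : U * R) := (xt.1, xt.2 + e * (a * cos (y xt.1 - theta))).
have mg e : measurable_fun setT (g e).
  apply: measurable_fun_pair; first exact: measurable_fst.
  apply: measurable_funD; first exact: measurable_snd.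
  do 2 apply: measurable_funM => //; apply: measurableT_comp; first exact: measurable_cos.
  by apply: measurable_funB => //; apply: measurableT_comp => //; exact: measurable_fst.
have mh (j : 'I_4) : measurable [set xt : U * R | hits r h theta m (om xt.1) (j :: v) xt.2].
  apply: (@measurable_hits _ _ _ _ _ (fun=> theta)); first exact: measurable_cst.
  by move=> s sm; rewrite -cat_rcons; apply: mom; rewrite -size_eq0 size_rcons.
have mA : measurable ((g (-1) @^-1` [set xt : U * R | hits r h theta m (om xt.1) (inord 0 :: v) xt.2]) `&`
    (g 1 @^-1` [set xt : U * R | hits r h theta m (om xt.1) (inord 2 :: v) xt.2])).
  by apply: measurableI; rewrite -[X in measurable X]setTI; apply: mg => //; exact: mh.
have := measurable_fun_xsection (@lebesgue_measure R) mA.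
congr (measurable_fun _ _); apply/funext => x /=; congr lebesgue_measure.
by apply/seteqP; split => t /=; rewrite /xsection/= inE /opposite_overlap/= mulN1r mul1r.
Qed.

(** Let [W] be the smaller of the two bounds on the [y_i]. Since [W <= 2 * a], the
expression [y_0 + y_2 - y_0 * y_2 / (16 * a)] is increasing in [y_0] and [y_2] on
[0, W]. So [y <= 4 W * (1 - W / (64 * a))], which is at most
[4 W / (1 + W / (64 * a))]; invert. *)
Lemma overlap_gain {R : realType} (a D y y0 y1 y2 y3 : R) : 0 < a -> 0 < D ->
  (forall y', y' \in [:: y0; y1; y2; y3] -> [/\ 0 <= y', y' <= D^-1 & y' <= 2 * a]) ->
  y + y0 * y2 / (16 * a) <= y0 + y2 + (y1 + y3) ->
  y <= ((16 * (16 * a))^-1 + D / 4)^-1.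
Proof.
move=> a0 D0 hy hle.
pose W := Num.min D^-1 (2 * a).
have W0 : 0 < W by rewrite /W lt_min invr_gt0 D0 mulr_gt0.
have WD : D <= W^-1 by rewrite -[leLHS]invrK lef_pV2 ?posrE ?invr_gt0// ge_min lexx.
have Wa : W <= 2 * a by rewrite ge_min lexx orbT.
have yW y' : y' \in [:: y0; y1; y2; y3] -> 0 <= y' <= W.
  by move=> /hy[y0' yD ya]; rewrite y0' le_min yD ya.
have /andP[? ?] := yW y0 (mem_head _ _).
have /andP[? ?] : 0 <= y1 <= W by apply: yW; rewrite !inE eqxx ?orbT.
have /andP[? ?] : 0 <= y2 <= W by apply: yW; rewrite !inE eqxx ?orbT.
have /andP[? ?] : 0 <= y3 <= W by apply: yW; rewrite !inE eqxx ?orbT.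
have Q0 : 0 < (16 * (16 * a))^-1 + W^-1 / 4 by rewrite addr_gt0// ?invr_gt0 ?divr_gt0 ?mulr_gt0// ?invr_gt0.
have QD : 0 < (16 * (16 * a))^-1 + D / 4 by rewrite addr_gt0// ?invr_gt0 ?divr_gt0 ?mulr_gt0// ?invr_gt0.
apply: (@le_trans _ _ ((16 * (16 * a))^-1 + W^-1 / 4)^-1); last first.
  by rewrite lef_pV2 ?posrE// lerD2l ler_pM2r.
have i0 : 0 < (16 * a)^-1 by rewrite invr_gt0 mulr_gt0.
have iW : (16 * a)^-1 * W <= 1 by rewrite mulrC ler_pdivrMr ?mulr_gt0// mul1r; nra.
have top : y <= 4 * W - W ^+ 2 / (16 * a).
  apply: le_trans (_ : y0 + y2 - y0 * y2 / (16 * a) + (W + W) <= _); first by lra.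
  move: i0 iW; rewrite -!/(_ / (16 * a)); set e := (16 * a)^-1 => i0 iW.
  have : 0 <= (W - y0) * (1 - e * W) + (W - y2) * (1 - e * y0).
    rewrite addr_ge0// mulr_ge0 ?subr_ge0//.
    by apply: le_trans iW; rewrite ler_pM2l.
  by rewrite expr2; lra.
apply: (le_trans top).
rewrite -[leRHS]div1r ler_pdivlMr//.
rewrite (_ : _ * _ = 1 - W ^+ 2 / (16 * a) / (16 * (16 * a))); last first.
  by field; rewrite !gt_eqF.
by rewrite gerBl !divr_ge0 ?sqr_ge0 ?mulr_ge0 ?(ltW a0).
Qed.

(** * Recursion for the mean length of the projection *)

Section mean_length.
Context {R : realType} (r : nat -> R) (h theta : R) d (T : measurableType d)
  (P : probability T R) {I : choiceType} (X : I -> {RV P >-> R}) (idx : word -> I).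
Hypothesis r_adm : admissible r.
Hypothesis h_gt0 : 0 < h.
Hypothesis theta_itv : 0 <= theta <= pi.
Hypothesis X_iid : iid_uniform_angles X.
(** Both models attach the angle [X (idx v)] to the word [v], with [idx] the size
or the identity. In both, the angle at [v] is then independent of everything that
happens inside its children. *)
Hypothesis idx_below : forall s v, s != [::] -> idx (s ++ v) <> idx v.

Let h_ge0 : 0 <= h := ltW h_gt0.

Definition angles (w : T) : word -> R := fun v => X (idx v) w.
Definition random_length m v (w : T) : \bar R := lebesgue_measure (hits r h theta m (angles w) v).
Definition mean_length m v : \bar R := (\int[P]_w random_length m v w)%E.

Lemma measurable_random_length m v : measurable_fun setT (random_length m v).
Proof.
apply: (@measurable_hits_length _ _ _ _ _ (fun=> theta)); first exact: measurable_cst.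
by move=> s _; exact: measurable_funP.
Qed.

Lemma integral_uniform_angle i (g : R -> \bar R) : measurable_fun setT g ->
  (forall x, 0 <= g x)%E ->
  (\int[P]_w g (X i w) = (2 * pi)^-1%:E * \int[lebesgue_measure]_(x in `[0%R, (2 * pi)%R]) g x)%E.
Proof.
move=> mg g0.
have mX0 : measurable_fun setT (X i) by exact: measurable_funP.
have mX : measurable_fun setT (X i : T -> measurableTypeR R) by move=> mD A mA; exact: mX0 mD A mA.
pose X' : {mfun T >-> measurableTypeR R} :=
  HB.pack (X i : T -> measurableTypeR R) (isMeasurableFun.Build _ _ _ _ _ mX).
have mg' : measurable_fun setT (g : measurableTypeR R -> \bar R) by move=> mD A mA; exact: mg mD A mA.
transitivity (\int[distribution P X']_x g x)%E.
  by rewrite ge0_integral_distribution.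
transitivity (\int[uniform_prob (@two_pi_gt0 R)]_x g x)%E.
  by apply: eq_measure_integral => A mA _; exact: X_iid.2.
by rewrite integral_uniform// subr0.
Qed.

(** Integrate over the angle at [v] first, which is legitimate since it is independent
of the angles below [v]: for fixed angles below, [opposite_overlap_average] applies. *)
Lemma mean_overlap m v : 0 < r (size v) - r (size v).+1 ->
  r (size v).+1 - r (size v + m.+1)%N + h <= r (size v) - r (size v).+1 ->
  (\int[P]_w (random_length m (inord 0 :: v) w * random_length m (inord 2 :: v) w) <=
   (4 * pi * (r (size v) - r (size v).+1))%:E *
   \int[P]_w lebesgue_measure (opposite_overlap r h theta m (angles w) v (angles w v)))%E.
Proof.
set a := r (size v) - r (size v).+1 => a0 ba.
pose J : set I := [set i | i <> idx v].
pose omJ (x : angle_space (R := R) J) : word -> R := fun u => (x : I -> R) (idx u).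
pose F (xy : angle_space (R := R) J * R) := lebesgue_measure (opposite_overlap r h theta m (omJ xy.1) v xy.2).
have mcoord s : s != [::] -> measurable_fun setT (fun x : angle_space J => omJ x (s ++ v)).
  by move=> s0; apply: measurable_coordinate; exact: idx_below.
have mF : measurable_fun setT F.
  apply: measurable_opposite_overlap; first exact: measurable_snd.
  by move=> s s0; apply: (measurableT_comp (mcoord s s0)); exact: measurable_fst.
have F0 x : (0 <= F x)%E by [].
have indep (A : set (angle_space J)) (B : set R) : measurable A -> measurable B ->
    P (sample X J @^-1` A `&` X (idx v) @^-1` B) =
    (P (sample X J @^-1` A) * P (X (idx v) @^-1` B))%E.
  move=> mA mB.
  have := @sample_independent _ _ _ P _ X X_iid.1 J [set idx v] _ A
    [set x : angle_space [set idx v] | B ((x : I -> R) (idx v))] mA _.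
  apply; first by move=> i Ji /= iv; exact: Ji.
  have := @measurable_coordinate I R [set idx v] (idx v) erefl measurableT B mB.
  by rewrite setTI.
have -> : (\int[P]_w lebesgue_measure (opposite_overlap r h theta m (angles w) v (angles w v)) =
    \int[P]_w F (sample X J w, X (idx v) w))%E by [].
rewrite (ge0_integral_decouple indep mF F0).
have c0 : 0 < 4 * pi * a by rewrite !mulr_gt0// pi_gt0.
rewrite -lee_pdivrMl// -ge0_integralZl//; last 3 first.
- by apply: emeasurable_funM; exact: measurable_random_length.
- by move=> w _; rewrite mule_ge0.
- by rewrite lee_fin invr_ge0 ltW.
apply: ge0_le_integral_nomeas => w _.
  by rewrite mule_ge0// ?mule_ge0// lee_fin invr_ge0 ltW.
rewrite (@integral_uniform_angle _ (fun x => F (sample X J w, x)))//; last first.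
  by apply: (measurableT_comp mF); exact: measurable_fun_pair.
rewrite lee_pdivrMl// muleA -EFinM.
have e (x y : R) : y != 0 -> 4 * y * x / (2 * y) = 2 * x by move=> y0; field.
rewrite e ?gt_eqF ?pi_gt0//.
exact: opposite_overlap_average.
Qed.

Lemma random_length_ge0 m v w : (0 <= random_length m v w)%E.
Proof. exact: measure_ge0. Qed.

Lemma mean_length_ge0 m v : (0 <= mean_length m v)%E.
Proof. by apply: integral_ge0 => w _; exact: random_length_ge0. Qed.

Lemma mean_length_le m v :
  (mean_length m v <= (2 * (r (size v) - r (size v + m)%N + h))%:E)%E.
Proof.
apply: (@le_trans _ _ (\int[P]_w (2 * (r (size v) - r (size v + m)%N + h))%:E)%E).
  by apply: ge0_le_integral_nomeas => w _; [exact: random_length_ge0|exact: hits_length_le].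
by rewrite integral_cst// [X in (_ * X)%E]probability_setT mule1.
Qed.

Lemma mean_length_fin m v : mean_length m v \is a fin_num.
Proof.
rewrite ge0_fin_numE; last exact: mean_length_ge0.
exact: le_lt_trans (mean_length_le m v) (ltry _).
Qed.

Lemma hits_same_angles m om u v : size u = size v ->
  (forall s, om (s ++ u) = om (s ++ v)) ->
  hits r h theta m om u = hits r h theta m om v.
Proof.
elim: m u v => [//|m IH] u v suv omE /=; apply/seteqP; split => t /= [j hj]; exists j.
  rewrite -suv -(omE [::]) -(IH (j :: u)) //=; first by rewrite suv.
  by move=> s; rewrite -!cat_rcons.
rewrite suv (omE [::]) (IH _ (j :: v)) //=; first by rewrite suv.
by move=> s; rewrite -!cat_rcons.
Qed.

(** If the siblings use the same angles then their lengths agree, and this is the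
inequality between the first and the second moment of one random variable. *)
Lemma correlation_same_angles m (u v : word) : size u = size v ->
  (forall s, idx (s ++ u) = idx (s ++ v)) ->
  (mean_length m u * mean_length m v <=
   \int[P]_w (random_length m u w * random_length m v w))%E.
Proof.
move=> suv idxE.
have lE w : random_length m u w = random_length m v w.
  by rewrite /random_length (hits_same_angles _ suv)// /angles => s; rewrite idxE.
have -> : mean_length m u = mean_length m v by apply: eq_integral => w _; rewrite lE.
under eq_integral do rewrite lE.
have : mean_length m v = (fine (mean_length m v))%:E by rewrite fineK// mean_length_fin.
have : 0 <= fine (mean_length m v) by rewrite fine_ge0// mean_length_ge0.
set y := fine _ => y0 Ey.
have mll : measurable_fun setT (fun w => random_length m v w * random_length m v w)%E.
  by apply: emeasurable_funM; exact: measurable_random_length.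
(* integrate [2 * y * x <= x ^ 2 + y ^ 2] with [x] the length and [y] its mean *)
have : ((2 * y * y)%:E <= \int[P]_w (random_length m v w * random_length m v w) + (y * y)%:E)%E.
  have -> : (y * y)%:E = (\int[P]_w (y * y)%:E)%E.
    by rewrite integral_cst// [X in (_ * X)%E]probability_setT mule1.
  rewrite EFinM -Ey -ge0_integralD//; last 2 first.
  - by move=> w _; rewrite mule_ge0 ?random_length_ge0.
  - by move=> w _; rewrite lee_fin mulr_ge0.
  rewrite -ge0_integralZl//; last 2 first.
  - exact: measurable_random_length.
  - by rewrite lee_fin mulr_ge0.
  apply: ge0_le_integral_nomeas => w _; first by rewrite mule_ge0 ?random_length_ge0 ?lee_fin ?mulr_ge0.
  have : random_length m v w \is a fin_num.
    rewrite ge0_fin_numE ?random_length_ge0//.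
    by apply: le_lt_trans; [exact: hits_length_le|exact: ltry].
  move=> /fineK <-; rewrite -!EFinM -EFinD lee_fin -subr_ge0.
  set x := fine _; rewrite (_ : _ - _ = (x - y) ^+ 2); first exact: sqr_ge0.
  ring.
rewrite Ey -EFinM.
case: (\int[P]_w (random_length m v w * random_length m v w))%E => [z||]//; last by move=> _; exact: leey.
by rewrite -EFinD !lee_fin; lra.
Qed.

(** If the siblings use disjoint sets of angles then their lengths are independent,
and equality holds. *)
Lemma correlation_disjoint_angles m (u v : word) :
  (forall s t, idx (s ++ u) <> idx (t ++ v)) ->
  (mean_length m u * mean_length m v <=
   \int[P]_w (random_length m u w * random_length m v w))%E.
Proof.
move=> disj.
pose J (u : word) : set I := [set i | exists s, i = idx (s ++ u)].
pose om (u : word) (x : angle_space (R := R) (J u)) : word -> R := fun u => (x : I -> R) (idx u).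
pose G (u : word) (x : angle_space (R := R) (J u)) := lebesgue_measure (hits r h theta m (om u x) u).
have mG u' : measurable_fun setT (G u').
  apply: (@measurable_hits_length _ _ _ _ _ (fun=> theta)); first exact: measurable_cst.
  by move=> s _; apply: measurable_coordinate; exists s.
pose F (xy : angle_space (R := R) (J u) * angle_space (R := R) (J v)) := (G u xy.1 * G v xy.2)%E.
have mF : measurable_fun setT F.
  apply: emeasurable_funM; apply: (measurableT_comp (mG _)).
    exact: measurable_fst.
  exact: measurable_snd.
have F0 x : (0 <= F x)%E by rewrite mule_ge0.
have indep := @sample_independent _ _ _ P _ X X_iid.1 (J u) (J v).
have -> : (\int[P]_w (random_length m u w * random_length m v w) =
    \int[P]_w F (sample X (J u) w, sample X (J v) w))%E by [].
rewrite (ge0_integral_decouple _ mF F0); last first.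
  by move=> A B mA mB; apply: indep => // i [s ->] [t]; exact: disj.
under eq_integral => w _.
  rewrite /F /= ge0_integralZl//; [|exact: measurable_random_length m v].
  over.
rewrite -[leRHS]/(\int[P]_w (random_length m u w * mean_length m v))%E ge0_integralZr//.
- exact: measurable_random_length.
- exact: mean_length_ge0.
Qed.

Hypothesis correlation : forall m v,
  (mean_length m (inord 0 :: v) * mean_length m (inord 2 :: v) <=
   \int[P]_w (random_length m (inord 0 :: v) w * random_length m (inord 2 :: v) w))%E.

(** The factor [16] absorbs [4 * pi] from [mean_overlap]. *)
Lemma mean_length_step m v (y : nat -> R) :
  (forall j, mean_length m (inord j :: v) = (y j)%:E) ->
  0 < r (size v) - r (size v).+1 ->
  r (size v).+1 - r (size v + m.+1)%N + h <= r (size v) - r (size v).+1 ->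
  fine (mean_length m.+1 v) + y 0%N * y 2 / (16 * (r (size v) - r (size v).+1)) <=
  y 0%N + y 2 + (y 1%N + y 3).
Proof.
set a := r (size v) - r (size v).+1 => E a0 ba.
pose O := (\int[P]_w lebesgue_measure (opposite_overlap r h theta m (angles w) v (angles w v)))%E.
have O0 : (0 <= O)%E by apply: integral_ge0 => w _; exact: measure_ge0.
have mO : measurable_fun setT (fun w => lebesgue_measure (opposite_overlap r h theta m (angles w) v (angles w v))).
  by apply: measurable_opposite_overlap => [|s _]; exact: measurable_funP.
have le1 : (mean_length m.+1 v + O <=
    mean_length m (inord 0 :: v) + mean_length m (inord 2 :: v) +
    (mean_length m (inord 1 :: v) + mean_length m (inord 3 :: v)))%E.
  have mD i j : measurable_fun setT (fun w => random_length m (i :: v) w + random_length m (j :: v) w)%E.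
    by apply: emeasurable_funD; exact: measurable_random_length.
  have D0 i j w : (0 <= random_length m (i :: v) w + random_length m (j :: v) w)%E.
    by rewrite adde_ge0 ?random_length_ge0.
  rewrite -!ge0_integralD//; try exact: measurable_random_length; try by move=> w _; exact: random_length_ge0.
  apply: ge0_le_integral_nomeas => w _; first by rewrite adde_ge0 ?random_length_ge0.
  exact: hits_length_step.
have le2 := le_trans (correlation m v) (mean_overlap a0 ba).
rewrite -/O -/a in le2.
move: le1 le2; rewrite !E => le1 le2.
have : O \is a fin_num.
  rewrite ge0_fin_numE//; apply: le_lt_trans (_ : mean_length m.+1 v + O < _)%E.
    by rewrite leeDr// mean_length_ge0.
  by apply: le_lt_trans le1 _; rewrite -!EFinD ltry.
move: (mean_length_fin m.+1 v) le1 le2 => /fineK <- + + /fineK oE.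
rewrite -oE -!EFinD -!EFinM !lee_fin => le1 le2.
apply: le_trans le1; rewrite lerD2l ler_pdivrMr ?mulr_gt0//.
apply: (le_trans le2); rewrite mulrC ler_wpM2l ?fine_ge0//.
rewrite ler_pM2r//; have := @pihalf_lt2 R; lra.
Qed.

(** The lower bound that the recursion yields for the inverse of the mean length:
up to constants, the energy of the radii from index [k] on, rescaled by [4^k]. *)
Fixpoint tail_energy m k : R :=
  if m is m'.+1 then (16 * (16 * r k))^-1 + tail_energy m' k.+1 / 4 else (2 * h)^-1.

Lemma tail_energy_gt0 m k : 0 < tail_energy m k.
Proof.
elim: m k => [|m IH] k /=; first by rewrite invr_gt0 mulr_gt0.
by rewrite ltr_wpDl ?divr_gt0// invr_ge0 !mulr_ge0//; case: r_adm.
Qed.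

(** The hypothesis on the radii says that the projections of two opposite children
fit into the range of their relative displacement; it is needed in
[overlap_average]. *)
Lemma mean_length_energy n m v :
  (forall k : nat, (k < n)%N -> r k.+1 - r n + h <= r k - r k.+1) ->
  (size v + m)%N = n -> (mean_length m v <= (tail_energy m (size v))^-1%:E)%E.
Proof.
move=> gap; elim: m v => [|m IH] v svn.
  by apply: (le_trans (mean_length_le 0 v)); rewrite addn0 subrr add0r /= invrK.
pose y j := fine (mean_length m (inord j :: v)).
have E j : mean_length m (inord j :: v) = (y j)%:E by rewrite /y fineK// mean_length_fin.
have vn : (size v < n)%N by rewrite -svn addnS ltnS leq_addr.
have ba := gap _ vn.
set a := r (size v) - r (size v).+1 in ba.
have a0 : 0 < a.
  apply: lt_le_trans ba; rewrite ltr_wpDl// subr_ge0.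
  by apply: (radii_nonincreasing r_adm).
have := @mean_length_step m v y E a0; rewrite svn => /(_ ba).
rewrite -/a => /(overlap_gain a0 (tail_energy_gt0 m (size v).+1)) H.
rewrite -(fineK (mean_length_fin m.+1 v)) lee_fin.
apply: (le_trans (H _)).
  have yj j : [/\ 0 <= y j, y j <= (tail_energy m (size v).+1)^-1 & y j <= 2 * a].
    split; first by rewrite fine_ge0// mean_length_ge0.
      by rewrite -lee_fin -E; apply: IH; rewrite -svn /= addSnnS.
    rewrite -lee_fin -E; apply: (le_trans (mean_length_le _ _)).
    by rewrite lee_fin ler_pM2l//= addSnnS svn.
  by move=> y'; rewrite !inE => /or4P[] /eqP ->; exact: yj.
rewrite lef_pV2 ?posrE; last 2 first.
- by rewrite addr_gt0// ?divr_gt0 ?tail_energy_gt0// invr_gt0 !mulr_gt0.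
- exact: tail_energy_gt0 m.+1 _.
rewrite /= lerD2r lef_pV2 ?posrE ?mulr_gt0//; last first.
  by apply: lt_le_trans a0 _; rewrite gerBl; case: r_adm.
by rewrite !ler_pM2l// gerBl; case: r_adm.
Qed.

Lemma energy_le_tail_energy m k (e : R) : 0 < e -> 2 * h <= 16 * (16 * e) ->
  energy (fun j => r (k + j)%N) m e / (16 * 16) <= tail_energy m k.
Proof.
move=> e0 he; elim: m k => [|m IH] k.
  rewrite /energy big_ord0 add0r expr0 div1r -invfM /= lef_pV2 ?posrE ?mulr_gt0//.
  by apply: le_trans he _; lra.
have step : energy (fun j => r (k + j)%N) m.+1 e =
    (r k)^-1 + energy (fun j => r (k.+1 + j)%N) m e / 4.
  rewrite /energy big_ord_recl/= expr0 addn0 div1r mulrDl -addrA; congr (_ + (_ + _)).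
    rewrite mulr_suml; apply: eq_bigr => j _.
    by rewrite exprS /bump/= add1n addnS addSn [RHS]mulrAC [4^-1 * _]mulrC.
  by rewrite exprS [RHS]mulrAC [4^-1 * _]mulrC.
rewrite step mulrDl; apply: lerD.
  by rewrite -invfM [r k * _]mulrC -mulrA.
by rewrite -/(tail_energy m k.+1) mulrAC ler_pM2r.
Qed.
End mean_length.

(** * Upper bound for the expected Favard length *)

Section upper_bound.
Context {R : realType} (r : nat -> R) d (T : measurableType d)
  (P : probability T R) {I : choiceType} (X : I -> {RV P >-> R}) (idx : word -> I).
Hypothesis r_adm : admissible r.
Hypothesis X_iid : iid_uniform_angles X.
Hypothesis idx_below : forall s v, s != [::] -> idx (s ++ v) <> idx v.
Hypothesis correlation : forall h theta m v, 0 < h -> 0 <= theta <= pi ->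
  (mean_length r h theta X idx m (inord 0 :: v) * mean_length r h theta X idx m (inord 2 :: v) <=
   \int[P]_w (random_length r h theta X idx m (inord 0 :: v) w * random_length r h theta X idx m (inord 2 :: v) w))%E.

(** The construction is stopped at scale [6 * rho] instead of [rho]: then above that level
[2 * rho <= r k / 3] and [r (k + 1) <= r k / 3], which leaves enough room for
the displacement [r k - r (k + 1)] to exceed [r (k + 1) + 2 * rho]. *)
Lemma expected_Fav_le rho n : 0 < rho -> r n <= 6 * rho ->
  (forall k : nat, (k < n)%N -> 6 * rho <= r k) ->
  (expected_Fav P r (fun w v => X (idx v) w) rho <=
   (4 * (16 * 16) / energy r n (6 * rho))%:E)%E.
Proof.
move=> rho0 rn above; pose h := r n + 2 * rho.
have r_ge0 k : 0 <= r k by case: r_adm.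
have h0 : 0 < h by rewrite ltr_wpDl ?mulr_gt0.
have E0 : 0 < energy r n (6 * rho).
  by rewrite ltr_wpDl ?divr_gt0 ?exprn_gt0 ?mulr_gt0 ?invr_gt0// sumr_ge0// => k _; rewrite divr_ge0 ?exprn_ge0 ?invr_ge0.
pose c := (16 * 16) / energy r n (6 * rho).
have c0 : 0 <= c by rewrite divr_ge0 ?mulr_ge0 ?ltW.
have gap (k : nat) : (k < n)%N -> r k.+1 - r n + h <= r k - r k.+1.
  move=> kn; have := above _ kn; have [_ _ /(_ k)] := r_adm.
  by move: rho0; rewrite /h; lra.
have mean_le theta : 0 <= theta <= pi -> (mean_length r h theta X idx n [::] <= c%:E)%E.
  move=> th.
  have corr m v := correlation m v h0 th.
  apply: le_trans (@mean_length_energy _ _ _ _ _ _ _ _ _ _ r_adm h0 th X_iid idx_below corr n n [::] gap _) _ => //.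
  rewrite lee_fin /c -[leRHS]invrK invfM invrK lef_pV2 ?posrE ?tail_energy_gt0//.
    rewrite mulrC; apply: (@energy_le_tail_energy _ r h h0 n 0); first by rewrite mulr_gt0.
    by rewrite /h; lra.
  by rewrite mulr_gt0// invr_gt0 mulr_gt0.
pose G (wt : T * R) := (lebesgue_measure (hits r h wt.2 n (fun v => X (idx v) wt.1) [::]) * (\1_`[0%R, pi] wt.2)%:E)%E.
have mG : measurable_fun setT G.
  apply: emeasurable_funM.
    apply: (@measurable_hits_length _ _ _ _ _ (fun wt : T * R => wt.2)); first exact: measurable_snd.
    by move=> s _; apply: measurableT_comp; [exact: measurable_funP|exact: measurable_fst].
  apply/measurable_EFinP; apply: measurableT_comp; last exact: measurable_snd.
  by apply: measurable_indic; exact: measurable_itv.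
have G0 x : (0 <= G x)%E by rewrite mule_ge0// lee_fin indicE.
pose mu : {sigma_finite_measure set _ -> \bar R} := (@lebesgue_measure R).
apply: (@le_trans _ _ (\int[P]_w \int[mu]_theta G (w, theta))%E).
  apply: ge0_le_integral_nomeas => w _; first by apply: integral_ge0.
  rewrite /Fav integral_mkcond; apply: ge0_le_integral_nomeas => theta _.
    by apply: erestrict_ge0 => ? _; exact: measure_ge0.
  rewrite patchE /G/= indicE; case: ifPn => th; last by rewrite mule0.
  rewrite mule1; apply: lebesgue_measure_mono.
  exact: proj_neighborhood_hits.
rewrite fubini_tonelli//.
apply: (@le_trans _ _ (\int[mu]_(theta in `[0%R, pi]) c%:E)%E).
  rewrite [leRHS]integral_mkcond; apply: ge0_le_integral_nomeas => theta _; first by apply: integral_ge0.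
  rewrite patchE /G; case: ifPn => th; last first.
    by under eq_integral do rewrite indicE/= (negbTE th) mule0; rewrite integral0.
  under eq_integral do rewrite indicE/= th mule1.
  by apply: mean_le; move: th; rewrite inE /= in_itv.
rewrite integral_cst//= lebesgue_measure_itv/= lte_fin pi_gt0 sube0 -EFinM lee_fin.
by rewrite -mulrA -/c mulrC ler_wpM2r//; have := @pihalf_lt2 R; lra.
Qed.

End upper_bound.

Lemma expected_Fav_ge {R : realType} (r : nat -> R) d (T : measurableType d)
    (P : probability T R) (om : T -> word -> R) rho n : admissible r ->
  0 < rho -> r n <= rho -> (forall k : nat, (k < n)%N -> rho <= r k) ->
  ((48^-1 / energy r n rho)%:E <= expected_Fav P r om rho)%E.
Proof.
move=> r_adm rho0 rn above.
have e0 : 0 <= 48^-1 / energy r n rho.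
  have [r0 _ _] := r_adm.
  rewrite divr_ge0 ?invr_ge0// addr_ge0 ?sumr_ge0// => [k _|];
    by rewrite divr_ge0 ?exprn_ge0 ?invr_ge0// ltW.
rewrite -[leLHS]mule1 -[X in (_ * X)%E](probability_setT P) -integral_cst//.
by apply: ge0_le_integral_nomeas => w _ //; exact: Fav_cantor_lower_bound.
Qed.

(** * Comparison with the profile *)

Section comparison.
Context {R : realType} (f : R -> R).
Hypothesis f_gt0 : forall x, 0 < x -> 0 < f x.
Hypothesis f_concave : convex_function (E := R^o) `]0, +oo[ (fun x => - f x).
Hypothesis f_mono : forall x y, 0 < x -> x <= y -> f x <= f y.
Hypothesis f_lim : derive1 f x @[x --> within [set x | derivable f x 1] +oo] --> (1 : R).

Let f_ratio := concave_ratio f_gt0 f_concave.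
Let f_ge := profile_ge_id f_gt0 f_concave f_lim.
Let f_lin := profile_lt_linear f_gt0 f_concave f_lim.

(** The upper bound is obtained at scale [6 * rho], and [f (6 * rho) <= 6 * f rho]. *)
Lemma expected_Fav_profile d (T : measurableType d) (P : probability T R)
    (I : choiceType) (X : I -> {RV P >-> R}) (idx : word -> I) rho :
  iid_uniform_angles X ->
  (forall s v, s != [::] -> idx (s ++ v) <> idx v) ->
  (forall h theta m v, 0 < h -> 0 <= theta <= pi ->
    (mean_length (radius f) h theta X idx m (inord 0 :: v) *
     mean_length (radius f) h theta X idx m (inord 2 :: v) <=
     \int[P]_w (random_length (radius f) h theta X idx m (inord 0 :: v) w *
                random_length (radius f) h theta X idx m (inord 2 :: v) w))%E) ->
  0 < rho ->
  ((48^-1 / 55 * f rho)%:E <= expected_Fav P (radius f) (fun w v => X (idx v) w) rho)%E /\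
  (expected_Fav P (radius f) (fun w v => X (idx v) w) rho <= (6 * (4 * (16 * 16)) * f rho)%:E)%E.
Proof.
move=> X_iid idx_below corr rho0.
have r_adm := radius_admissible f_gt0 f_ge.
have profile := energy_profile f_gt0 f_mono f_ratio f_ge f_lin.
split.
  have [n [rn above]] := exists_level r_adm rho0.
  have [eg el] := profile _ _ rho0 rn above.
  apply: le_trans (expected_Fav_ge P _ r_adm rho0 rn above); rewrite lee_fin.
  rewrite -mulrA ler_pM2l ?invr_gt0// -[leLHS]invrK lef_pV2 ?posrE.
  - by rewrite invfM invrK.
  - by rewrite invr_gt0 mulr_gt0 ?invr_gt0 ?f_gt0.
  - by apply: lt_le_trans eg; rewrite invr_gt0 f_gt0.
have rho6 : 0 < 6 * rho by rewrite mulr_gt0.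
have [n [rn above]] := exists_level r_adm rho6.
have [eg _] := profile _ _ rho6 rn above.
apply: (le_trans (expected_Fav_le r_adm X_iid idx_below corr rho0 rn above)).
rewrite lee_fin [6 * (4 * _)]mulrC -[leRHS]mulrA ler_pM2l ?mulr_gt0//.
apply: (@le_trans _ _ (f (6 * rho))).
  rewrite -[leRHS]invrK lef_pV2 ?posrE ?invr_gt0 ?f_gt0//.
  by apply: lt_le_trans eg; rewrite invr_gt0 f_gt0.
rewrite -(ler_pM2l rho0) mulrCA [leRHS]mulrA.
by apply: f_ratio => //; lra.
Qed.

End comparison.

Theorem theorem1p9 (R : realType) :
  exists c C : R, 0 < c /\ c <= C /\
  forall f : R -> R,
    (forall x, 0 < x -> 0 < f x) ->
    convex_function (E := R^o) `]0, +oo[ (fun x => - f x) ->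
    (forall x y, 0 < x -> x <= y -> f x <= f y) ->
    derive1 f x @[x --> within [set x | derivable f x 1] +oo] --> (1 : R) ->
    exists r : nat -> R, admissible r /\
      (forall (d : measure_display) (T : measurableType d)
         (P : probability T R) (X : nat -> {RV P >-> R}),
         iid_uniform_angles X ->
         forall rho : R, 0 < rho ->
           ((c * f rho)%:E <= expected_Fav P r (synchronized_angles X) rho)%E /\
           (expected_Fav P r (synchronized_angles X) rho <= (C * f rho)%:E)%E) /\
      (forall (d : measure_display) (T : measurableType d)
         (P : probability T R) (X : word -> {RV P >-> R}),
         iid_uniform_angles X ->
         forall rho : R, 0 < rho ->
           ((c * f rho)%:E <= expected_Fav P r (independent_angles X) rho)%E /\
           (expected_Fav P r (independent_angles X) rho <= (C * f rho)%:E)%E).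
Proof.
exists (48^-1 / 55), (6 * (4 * (16 * 16))); split; first by rewrite divr_gt0.
split; first by lra.
move=> f f_gt0 f_concave f_mono f_lim.
have r_adm := radius_admissible f_gt0 (profile_ge_id f_gt0 f_concave f_lim).
have size_below (s v : word) : s != [::] -> size (s ++ v) <> size v.
  by rewrite -size_eq0 size_cat -[X in _ <> X]add0n => s0 /addIn /eqP; exact/negP.
exists (radius f); split => //; split => d T P X X_iid rho rho0.
  apply: (@expected_Fav_profile _ f f_gt0 f_concave f_mono f_lim _ _ _ _ X size) => //.
  move=> h theta m v h0 th.
  by apply: correlation_same_angles => // s; rewrite !size_cat.
have below (s v : word) : s != [::] -> s ++ v <> v.
  by move=> s0 /(congr1 size); exact: size_below.
apply: (@expected_Fav_profile _ f f_gt0 f_concave f_mono f_lim _ _ _ _ X id) => //.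
move=> h theta m v h0 th; apply: correlation_disjoint_angles => // s t st.
have st_size : size s = size t.
  by move: (congr1 size st) => /eqP; rewrite !size_cat /= eqn_add2r => /eqP.
move: st => /eqP; rewrite eqseq_cat// => /andP[_ /eqP[]].
by move=> /(congr1 val); rewrite /= !inordK.
Qed.
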